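(* Let $f:\mathbb{C}\to\hat{\mathbb{C}}$ be meromorphic, let $U$ be a bounded component of $F(f)$ and let $V$ be the component of $F(f)$ such that $f(U)\subset V$. Then $f$ maps each component of $\partial U$ onto a component of $\hat{\partial}V$; that is, for every connected component $\alpha$ of $\partial U$, the image $f(\alpha)$ is a connected component of $\hat{\partial}V$.
   Context: The Fatou set $F(f)$ is the set of points $z\in\mathbb{C}$ such that the iterates $(f^n)_{n\in\mathbb{N}}$ are well-defined, meromorphic and form a normal family in some neighbourhood of $z$. For a set $D\subset\mathbb{C}$, $\partial D$ denotes the boundary of $D$ in $\mathbb{C}$, and $\hat{\partial}D$ denotes the boundary of $D$ in the Riemann sphere $\hat{\mathbb{C}}$. *)

(* Defs.v *)
From mathcomp Require Import all_boot all_order all_algebra.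
From mathcomp Require Import all_classical all_reals all_analysis.
From mathcomp Require Import complex.

Set Implicit Arguments.
Unset Strict Implicit.
Unset Printing Implicit Defensive.

Import Order.TTheory GRing.Theory Num.Theory.
Import numFieldNormedType.Exports.
Import Normc.

Local Open Scope classical_set_scope.
Local Open Scope ring_scope.

(* [R[i]] packed as a numClosedFieldType, so that it receives the norm topology
   that MathComp-Analysis puts on every numFieldType; in particular [derivable]
   over this field means complex differentiable. *)
Definition Cplx (R : realType) : numClosedFieldType := R[i].

Definition sphere (R : realType) := one_point_compactification (Cplx R).

Definition infty (R : realType) : sphere R := None.
Arguments infty {R}.

Definition in_sphere (R : realType) (A : set (Cplx R)) : set (sphere R) :=
  [set (Some z : sphere R) | z in A].

Definition boundary (T : topologicalType) (A : set T) : set T :=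
  closure A `\` interior A.

Definition is_component (T : topologicalType) (A B : set T) : Prop :=
  exists2 x, A x & B = connected_component A x.

Definition chordal (R : realType) (p q : sphere R) : R :=
  match p, q with
  | Some z, Some w => 2 * normc (z - w) /
      (Num.sqrt (1 + normc z ^+ 2) * Num.sqrt (1 + normc w ^+ 2))
  | Some z, None | None, Some z => 2 / Num.sqrt (1 + normc z ^+ 2)
  | None, None => 0
  end.

Definition holomorphic_at (R : realType) (g : Cplx R -> sphere R)
    (z : Cplx R) : Prop :=
  exists h : Cplx R -> Cplx R,
    \forall w \near z, g w = Some (h w) /\ derivable h w 1.

Definition pole_at (R : realType) (g : Cplx R -> sphere R)
    (z : Cplx R) : Prop :=
  [/\ g z = infty, g w @[w --> z^'] --> (infty : sphere R) &
      \forall w \near z^', holomorphic_at g w].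

Definition meromorphic_on (R : realType) (D : set (Cplx R))
    (g : Cplx R -> sphere R) : Prop :=
  forall z, D z -> holomorphic_at g z \/ pole_at g z.

Definition locally_uniform_cvg (R : realType) (D : set (Cplx R))
    (u : nat -> Cplx R -> sphere R) (g : Cplx R -> sphere R) : Prop :=
  forall z, D z -> exists2 N, nbhs z N &
    forall eps : R, 0 < eps ->
      \forall n \near \oo, forall w, N w -> chordal (u n w) (g w) < eps.

Definition normal_family (R : realType) (D : set (Cplx R))
    (F : set (Cplx R -> sphere R)) : Prop :=
  forall u : nat -> Cplx R -> sphere R, (forall n, F (u n)) ->
    exists phi : nat -> nat, increasing_seq phi /\
      exists g, locally_uniform_cvg D (u \o phi) g.

(* Since [f] is not defined at infinity, the value [infty] propagated by
   [iterate] past a pole is a dummy; the [n]-th iterate is a genuine value at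
   [z] only under [iterate_defined f n z]. *)
Definition iterate (R : realType) (f : Cplx R -> sphere R) (n : nat)
    (z : Cplx R) : sphere R :=
  iter n (fun p : sphere R => if p is Some w then f w else infty) (Some z).

Definition iterate_defined (R : realType) (f : Cplx R -> sphere R) (n : nat)
    (z : Cplx R) : Prop :=
  forall k, (k < n)%N -> iterate f k z <> infty.

Definition fatou_set (R : realType) (f : Cplx R -> sphere R) : set (Cplx R) :=
  [set z | exists N : set (Cplx R),
    [/\ open N /\ N z,
        forall n w, N w -> iterate_defined f n w,
        forall n, meromorphic_on N (iterate f n) &
        normal_family N (range (iterate f))]].

(* Main.v *)
Require Import Defs.
From mathcomp Require Import all_boot all_order all_algebra.
From mathcomp Require Import all_classical all_reals all_analysis.
From mathcomp Require Import complex.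
From mathcomp Require Import ring lra.

Set Implicit Arguments.
Unset Strict Implicit.
Unset Printing Implicit Defensive.

Import Order.TTheory GRing.Theory Num.Theory.
Import numFieldNormedType.Exports.
Import Normc.
Local Open Scope classical_set_scope.
Local Open Scope ring_scope.

(** Let beta be the component of the boundary of V that contains f(alpha), and
    suppose that some w0 in beta is not attained on alpha.

    Since alpha is an intersection of relatively clopen subsets of the compact
    set boundary U ([component_clopen_split]), boundary U splits into disjoint
    compact sets A, containing alpha, and B, with w0 outside f(A).  A
    neighbourhood W of A whose closure misses B cuts U along a compact subset D
    of U, and K = f(D) is compact in V.  The open set G = W /\ U has its
    boundary in A \/ D, and f(A) lies outside V, because a point that f sends
    into the Fatou set is itself in the Fatou set ([fatou_preimage]).  Hence
    f(G) minus K is open, as a consequence of the maximum modulus principle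
    ([meromorphic_image_nbhs]), and it is also relatively closed in V minus K.
    So V minus K is the disjoint union of two open sets: O = f(G) minus K,
    which accumulates at f(alpha), and the rest O', which accumulates at w0.
    Both limit points lie in the connected set beta, which is disjoint from V.

    This is impossible on the sphere, and here simple connectedness enters (on
    a torus it can happen).  Glue two copies of V to two copies of the
    complement of K, without exchanging the copies over O and exchanging them
    over O'.  This is a two-sheeted cover of the sphere, hence trivial; a
    section of it is constant on V and on beta, which forces O and O' to
    induce the same gluing ([continuum_in_one_side]).

    The hypothesis on f is complex differentiability with no continuity of the
    derivative, so the maximum modulus principle is derived from scratch.
    Goursat's bisection shows that a differentiable closed 1-form u dx - v dy
    has a primitive F on squares ([closed_form_exact]).  When u + iv is
    differentiable, F is twice differentiable in each variable and harmonic, so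
    its difference quotients obey the elementary maximum principle, and these
    quotients are values of u: therefore u has no strict paraboloid maximum
    ([harmonic_no_paraboloid_max]).  Adding a small multiple of the squared
    distance to a real part reduces the general maximum principle to this. *)

(** * Calculus on the real line *)

Section RealCalculus.
Variable R : realType.
Implicit Types (f g F : R -> R) (a b c d x y k e : R).

Lemma continuous_epsP f x : {for x, continuous f} <->
  forall e, 0 < e -> exists2 d, 0 < d &
    forall s, `|s - x| < d -> `|f s - f x| < e.
Proof.
split.
  move=> /cvgrPdist_lt cf e /cf /nbhs_ballP[d /= d0 H].
  by exists d => // s sx; rewrite distrC; apply: H; rewrite /ball /= distrC.
move=> H; apply/cvgrPdist_lt => e /H[d d0 {}H].
apply/nbhs_ballP; exists d => //= s; rewrite /ball /= distrC => /H.
by rewrite distrC.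
Qed.

Lemma is_derive_epsP f x k : is_derive x 1 f k <->
  forall e, 0 < e -> exists2 d, 0 < d &
    forall s, `|s - x| < d -> `|f s - f x - k * (s - x)| <= e * `|s - x|.
Proof.
split.
  move=> /is_derive1_caratheodory[g [fE /continuous_epsP cg gx]] e /cg[d d0 H].
  exists d => // s sx; rewrite fE -gx -mulrBl normrM ler_wpM2r//.
  exact/ltW/H.
move=> H; apply/is_derive1_caratheodory.
exists (fun s => if s == x then k else (f s - f x) / (s - x)); split.
- move=> z; case: eqP => [->|/eqP zx]; first by rewrite !subrr mulr0.
  by rewrite divfK// subr_eq0.
- apply/continuous_epsP => e e0; have e20 : 0 < e / 2 by rewrite divr_gt0.
  have [d d0 {}H] := H _ e20; exists d => // s sx; rewrite eqxx.
  case: eqP => [_|/eqP sNx]; first by rewrite subrr normr0.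
  have sx0 : s - x != 0 by rewrite subr_eq0.
  apply: (@le_lt_trans _ _ (e / 2)); last by rewrite ltr_pdivrMr// ltr_pMr// ltr1n.
  rewrite -(@ler_pM2r _ `|s - x|) ?normr_gt0// -normrM mulrBl divfK//.
  exact: H.
- by rewrite eqxx.
Qed.

Lemma is_derive_continuous f x k : is_derive x 1 f k -> {for x, continuous f}.
Proof. by case=> /derivable1_diffP/differentiable_continuous. Qed.

(** Parametrising the segment from a to b by [0, 1] makes the statement
    insensitive to the order of a and b; rectangles below may then have sides
    of either sign. *)
Lemma mvt_segment F f a b :
  (forall t : R, 0 <= t <= 1 -> is_derive (a + t * (b - a)) 1 F (f (a + t * (b - a)))) ->
  exists2 t : R, 0 <= t <= 1 & F b - F a = f (a + t * (b - a)) * (b - a).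
Proof.
move=> dF; pose G (t : R) := F (a + t * (b - a)).
have dG (t : R) : 0 <= t <= 1 -> is_derive t 1 G (f (a + t * (b - a)) * (b - a)).
  move=> /dF dFt; apply: is_derive1_comp.
  apply/is_derive_epsP => e e0; exists 1 => // s _.
  rewrite (_ : a + s * (b - a) - (a + t * (b - a)) - (b - a) * (s - t) = 0).
    by rewrite normr0; apply: mulr_ge0 => //; exact: ltW.
  by ring.
have [|||t] := @MVT_segment R G (fun t => f (a + t * (b - a)) * (b - a)) 0 1.
- exact: ler01.
- by move=> t; rewrite in_itv /= => /andP[t0 t1]; apply: dG; rewrite !ltW.
- apply: continuous_in_subspaceT => t; rewrite inE /= in_itv /= => t01.
  exact: is_derive_continuous (dG _ t01).
rewrite in_itv /= => t01; rewrite /G mul1r mul0r addr0 subr0 mulr1.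
by rewrite (addrC a) subrK => E; exists t.
Qed.

Lemma mvt_bound F f k M a b :
  (forall t : R, 0 <= t <= 1 -> is_derive (a + t * (b - a)) 1 F (f (a + t * (b - a)))) ->
  (forall t : R, 0 <= t <= 1 -> `|f (a + t * (b - a)) - k| <= M) ->
  `|F b - F a - k * (b - a)| <= M * `|b - a|.
Proof.
move=> /mvt_segment[t t01 ->] fM; rewrite -mulrBl normrM ler_wpM2r//.
exact: fM.
Qed.

Lemma antiderivative f a b :
  (forall x, a <= x <= b -> {for x, continuous f}) ->
  exists F, forall x, a < x < b -> is_derive x 1 F (f x).
Proof.
move=> cf.
pose F y := (\int[@lebesgue_measure R]_(t in `[a, y]) (f t))%R.
exists F => x /andP[ax xb].
have [] := @continuous_FTC1_closed R f a x b xb _ ax _.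
- apply: continuous_compact_integrable; first exact: segment_compact.
  apply: continuous_in_subspaceT => t; rewrite inE /= in_itv /=; exact: cf.
- by apply: cf; rewrite !ltW.
move=> dF F'; split; first exact: dF.
by rewrite -derive1E; exact: F'.
Qed.

End RealCalculus.

(** * Differentiable closed 1-forms on a square are exact *)

Definition affine_approx (R : realType) (P : R -> R -> R) (x y a b : R) :=
  forall e, 0 < e -> exists2 d, 0 < d &
    forall s t, `|s - x| < d -> `|t - y| < d ->
      `|P s t - (P x y + a * (s - x) + b * (t - y))| <=
        e * (`|s - x| + `|t - y|).

Section Goursat.
Variable R : realType.
Implicit Types (P Q A B : R -> R -> R) (a b c d x y e : R).

Lemma affine_approx_derive1 P x y a b :
  affine_approx P x y a b -> is_derive x 1 (fun s => P s y) a.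
Proof.
move=> H; apply/is_derive_epsP => e /H[d d0 {}H]; exists d => // s sx.
have := H s y sx; rewrite subrr normr0 mulr0 !addr0 => /(_ d0).
by rewrite opprD addrA.
Qed.

Lemma affine_approx_derive2 P x y a b :
  affine_approx P x y a b -> is_derive y 1 (P x) b.
Proof.
move=> H; apply/is_derive_epsP => e /H[d d0 {}H]; exists d => // t ty.
have := H x t; rewrite subrr normr0 mulr0 !addr0 add0r => /(_ d0 ty).
by rewrite opprD addrA.
Qed.

(** Primitive of an affine function along a side of a rectangle. *)
Lemma is_derive_quadratic (p a q x r : R) :
  is_derive r 1 (fun z : R => p * z + a * (z - x) ^+ 2 / 2 + q * z)
    (p + a * (r - x) + q).
Proof.
apply/is_derive_epsP => e e0.
have p0 : 0 < `|a| / 2 + 1 by rewrite ltr_wpDl.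
exists (e / (`|a| / 2 + 1)); first by rewrite divr_gt0.
move=> z zr.
have -> : p * z + a * (z - x) ^+ 2 / 2 + q * z -
    (p * r + a * (r - x) ^+ 2 / 2 + q * r) - (p + a * (r - x) + q) * (z - r) =
  a / 2 * (z - r) * (z - r) by field.
rewrite normrM ler_wpM2r// normrM normrM [`|2^-1|]ger0_norm ?invr_ge0//.
apply: (@le_trans _ _ ((`|a| / 2 + 1) * `|z - r|)).
  by rewrite ler_wpM2r// lerDl.
by rewrite mulrC -ler_pdivlMr// ltW.
Qed.

(** Integral of P dx + Q dy around the rectangle with corners (a, c) and (b, d),
    written with a primitive A of P in the first variable and a primitive B of
    Q in the second one, so that no integral has to be manipulated. *)
Definition loop_integral A B a b c d :=
  (A b c - A a c) + (B b d - B b c) - (A b d - A a d) - (B a d - B a c).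

(** Near (x, y) the form differs from an affine one by o(L), and the sides have
    length O(L).  The affine part contributes nothing because the two cross
    coefficients of P and Q agree (both are b): the form is closed. *)
Lemma loop_integral_small P Q A B x y a b c :
  affine_approx P x y a b -> affine_approx Q x y b c ->
  forall e, 0 < e -> exists2 d, 0 < d &
  forall L s w t h, L < d ->
    (forall l : R, 0 <= l <= 1 -> `|s + l * w - x| <= L) ->
    (forall l : R, 0 <= l <= 1 -> `|t + l * h - y| <= L) ->
    (forall l l' : R, 0 <= l <= 1 -> 0 <= l' <= 1 ->
       is_derive (s + l * w) 1 (fun z => A z (t + l' * h)) (P (s + l * w) (t + l' * h))) ->
    (forall l l' : R, 0 <= l <= 1 -> 0 <= l' <= 1 ->
       is_derive (t + l * h) 1 (B (s + l' * w)) (Q (s + l' * w) (t + l * h))) ->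
    `|loop_integral A B s (s + w) t (t + h)| <= e * L ^+ 2.
Proof.
move=> HP HQ e e0.
have e10 : 0 < e / 16 by rewrite divr_gt0.
have [dP dP0 {}HP] := HP _ e10; have [dQ dQ0 {}HQ] := HQ _ e10.
exists (Num.min dP dQ); first by rewrite lt_min dP0.
move=> L s w t h; rewrite lt_min => /andP[LP LQ] Hs Ht dA dB.
have i0 : 0 <= (0 : R) <= 1 by rewrite lexx ler01.
have i1 : 0 <= (1 : R) <= 1 by rewrite lexx ler01.
have L0 : 0 <= L by rewrite (le_trans _ (Hs 0 i0)).
have w2L : `|w| <= 2 * L.
  have := Hs 0 i0; have := Hs 1 i1; rewrite mul1r mul0r addr0 => H1 H0.
  rewrite (_ : w = (s + w - x) - (s - x)); last by ring.
  by rewrite (le_trans (ler_normB _ _))// mulr_natl mulr2n lerD.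
have h2L : `|h| <= 2 * L.
  have := Ht 0 i0; have := Ht 1 i1; rewrite mul1r mul0r addr0 => H1 H0.
  rewrite (_ : h = (t + h - y) - (t - y)); last by ring.
  by rewrite (le_trans (ler_normB _ _))// mulr_natl mulr2n lerD.
(* Integrals along a horizontal and a vertical side, minus those of the affine
   approximation. *)
pose KA t' := A (s + w) t' - A s t' -
  (P x y * w + a * ((s + w - x) ^+ 2 - (s - x) ^+ 2) / 2 + b * (t' - y) * w).
pose KB s' := B s' (t + h) - B s' t -
  (Q x y * h + c * ((t + h - y) ^+ 2 - (t - y) ^+ 2) / 2 + b * (s' - x) * h).
have bound l' : 0 <= l' <= 1 -> `|KA (t + l' * h)| <= e / 4 * L ^+ 2.
  move=> l'1.
  pose G z := A z (t + l' * h) - (P x y * z + a * (z - x) ^+ 2 / 2 + b * (t + l' * h - y) * z).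
  pose g z := P z (t + l' * h) - (P x y + a * (z - x) + b * (t + l' * h - y)).
  have dG (l : R) : 0 <= l <= 1 -> is_derive (s + l * w) 1 G (g (s + l * w)).
    move=> l1; apply: is_deriveB; first exact: dA.
    exact: is_derive_quadratic.
  have := @mvt_bound R G g 0 (e / 16 * (2 * L)) s (s + w).
  rewrite (addrC s w) addrK => /(_ dG); rewrite mul0r subr0.
  have gb (l : R) : 0 <= l <= 1 -> `|g (s + l * w) - 0| <= e / 16 * (2 * L).
    move=> l1; rewrite subr0 (le_trans (HP _ _ _ _))//.
    - exact: le_lt_trans (Hs _ l1) _.
    - exact: le_lt_trans (Ht _ l'1) _.
    rewrite ler_pM2l// mulr_natl mulr2n lerD ?Hs ?Ht//.
  move=> /(_ gb) H.
  rewrite (_ : KA _ = G (w + s) - G s); last first.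
    by rewrite /KA /G (addrC w s); field.
  apply: (le_trans H); rewrite (_ : e / 4 * L ^+ 2 = e / 16 * (2 * L) * (2 * L)); last by field.
  by rewrite ler_wpM2l// !mulr_ge0// ?ltW.
have boundB l' : 0 <= l' <= 1 -> `|KB (s + l' * w)| <= e / 4 * L ^+ 2.
  move=> l'1.
  pose G z := B (s + l' * w) z - (Q x y * z + c * (z - y) ^+ 2 / 2 + b * (s + l' * w - x) * z).
  pose g z := Q (s + l' * w) z - (Q x y + c * (z - y) + b * (s + l' * w - x)).
  have dG (l : R) : 0 <= l <= 1 -> is_derive (t + l * h) 1 G (g (t + l * h)).
    move=> l1; apply: is_deriveB; first exact: dB.
    exact: is_derive_quadratic.
  have := @mvt_bound R G g 0 (e / 16 * (2 * L)) t (t + h).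
  rewrite (addrC t h) addrK => /(_ dG); rewrite mul0r subr0.
  have gb (l : R) : 0 <= l <= 1 -> `|g (t + l * h) - 0| <= e / 16 * (2 * L).
    move=> l1; rewrite subr0 /g addrAC (le_trans (HQ _ _ _ _))//.
    - exact: le_lt_trans (Hs _ l'1) _.
    - exact: le_lt_trans (Ht _ l1) _.
    rewrite ler_pM2l// mulr_natl mulr2n lerD ?Hs ?Ht//.
  move=> /(_ gb) H.
  rewrite (_ : KB _ = G (h + t) - G t); last first.
    by rewrite /KB /G (addrC h t); field.
  apply: (le_trans H); rewrite (_ : e / 4 * L ^+ 2 = e / 16 * (2 * L) * (2 * L)); last by field.
  by rewrite ler_wpM2l// !mulr_ge0// ?ltW.
have := bound 0 i0; have := bound 1 i1; have := boundB 0 i0; have := boundB 1 i1.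
rewrite !mul1r !mul0r !addr0 => b1 b0 a1 a0.
rewrite (_ : loop_integral _ _ _ _ _ _ = KA t + KB (s + w) - KA (t + h) - KB s); last first.
  by rewrite /loop_integral /KA /KB; field.
rewrite (_ : e * L ^+ 2 = e / 4 * L ^+ 2 + e / 4 * L ^+ 2 + e / 4 * L ^+ 2 + e / 4 * L ^+ 2); last by field.
apply: (le_trans (ler_normB _ _)); apply: lerD => //.
apply: (le_trans (ler_normB _ _)); apply: lerD => //.
by apply: (le_trans (ler_normD _ _)); apply: lerD.
Qed.

End Goursat.

Section LoopIntegral.
Variable R : realType.
Implicit Types (P Q A B : R -> R -> R) (a b c d x y e : R).

Lemma nested_intervals (u q : nat -> R) :
  (forall n, 0 <= q n) -> (forall n, u n <= u n.+1) ->
  (forall n, u n.+1 + q n.+1 <= u n + q n) ->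
  exists l, forall n, u n <= l <= u n + q n.
Proof.
move=> q0 u_nd uq_ni.
have ub m n : u n <= u m + q m.
  have [mn|nm] := leP m n.
    have /nonincreasing_seqP/(_ m n mn) H : forall n, u n.+1 + q n.+1 <= u n + q n by [].
    by rewrite (le_trans _ H)// lerDl.
  have /nondecreasing_seqP/(_ n m (ltnW nm)) H : forall n, u n <= u n.+1 by [].
  by rewrite (le_trans H)// lerDl.
have hs : has_sup (range u).
  by split; [exists (u 0); exists 0 | exists (u 0 + q 0) => _ [n _ <-]].
exists (sup (range u)) => n; apply/andP; split.
  by apply: sup_upper_bound => //; exists n.
by apply: ge_sup => [|_ [m _ <-]//]; exists (u 0); exists 0.
Qed.

Lemma exists_half_pow_lt d : 0 < d -> exists n, (2 ^- n : R) < d.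
Proof.
move=> d0; exists (Num.truncn d^-1).+1.
rewrite -[X in _ < X]invrK ltf_pV2 ?posrE ?exprn_gt0 ?invr_gt0//.
rewrite (lt_le_trans (truncnS_gt _))// -natrX ler_nat.
exact/ltnW/ltn_expl.
Qed.

(** Goursat's argument: if the loop integral had absolute value eta > 0, repeated
    quartering would give nested rectangles whose integrals are at least
    eta / 4^n, which contradicts [loop_integral_small] at their common point. *)
Lemma loop_integral_eq0 P Q A B s w t h :
  (forall l m : R, 0 <= l <= 1 -> 0 <= m <= 1 -> exists a b c,
     affine_approx P (s + l * w) (t + m * h) a b /\
     affine_approx Q (s + l * w) (t + m * h) b c) ->
  (forall l m : R, 0 <= l <= 1 -> 0 <= m <= 1 ->
     is_derive (s + l * w) 1 (fun z => A z (t + m * h)) (P (s + l * w) (t + m * h))) ->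
  (forall l m : R, 0 <= l <= 1 -> 0 <= m <= 1 ->
     is_derive (t + m * h) 1 (B (s + l * w)) (Q (s + l * w) (t + m * h))) ->
  loop_integral A B s (s + w) t (t + h) = 0.
Proof.
move=> hPQ dA dB; apply/eqP; rewrite -normr_le0 leNgt; apply/negP.
set eta := `|_| => eta0.
pose q n : R := 2 ^- n.
have qS n : q n = q n.+1 + q n.+1.
  by rewrite /q exprS invfM; field; rewrite expf_neq0.
have q0 n : 0 < q n by rewrite invr_gt0 exprn_gt0.
(* A dyadic rectangle of generation n is given by the relative position p of
   its corner in the original rectangle. *)
pose T n (p : R * R) := loop_integral A B (s + p.1 * w) (s + p.1 * w + q n * w)
                           (t + p.2 * h) (t + p.2 * h + q n * h).
pose inv n (p : R * R) := [/\ 0 <= p.1, p.1 + q n <= 1, 0 <= p.2, p.2 + q n <= 1 &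
   eta * q n ^+ 2 <= `|T n p|].
have /boolp.choice[nxt nxtP] : forall k : nat * (R * R), exists k' : R * R,
    inv k.1 k.2 -> inv k.1.+1 k' /\
    [/\ k.2.1 <= k'.1, k'.1 + q k.1.+1 <= k.2.1 + q k.1,
        k.2.2 <= k'.2 & k'.2 + q k.1.+1 <= k.2.2 + q k.1].
  move=> [n [u v]] /=.
  have [iuv|?] := pselect (inv n (u, v)); last by exists (0, 0).
  have [u0 u1 v0 v1 Tuv] := iuv; rewrite /= in u0 u1 v0 v1.
  have [qn qn1] := (qS n, q0 n.+1).
  suff [u' [v' [u'E v'E Tle]]] : exists u' v', [/\ u' = u \/ u' = u + q n.+1,
      v' = v \/ v' = v + q n.+1 & eta * q n.+1 ^+ 2 <= `|T n.+1 (u', v')|].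
    exists (u', v') => _; rewrite /inv /=.
    by move: Tle; case: u'E => ->; case: v'E => -> Tle; split; split => //; lra.
  apply: contrapT => H.
  have K u' v' : u' = u \/ u' = u + q n.+1 -> v' = v \/ v' = v + q n.+1 ->
      `|T n.+1 (u', v')| < eta * q n.+1 ^+ 2.
    by move=> Hu Hv; rewrite ltNge; apply/negP => ?; apply: H; exists u', v'.
  have K1 := K u v (or_introl erefl) (or_introl erefl).
  have K2 := K _ v (or_intror erefl) (or_introl erefl).
  have K3 := K u _ (or_introl erefl) (or_intror erefl).
  have K4 := K _ _ (or_intror erefl) (or_intror erefl).
  have E : T n (u, v) = T n.+1 (u, v) + T n.+1 (u + q n.+1, v) +
      T n.+1 (u, v + q n.+1) + T n.+1 (u + q n.+1, v + q n.+1).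
    rewrite /T /= qn.
    have -> : s + (u + q n.+1) * w = s + u * w + q n.+1 * w by ring.
    have -> : t + (v + q n.+1) * h = t + v * h + q n.+1 * h by ring.
    have -> : s + u * w + (q n.+1 + q n.+1) * w = s + u * w + q n.+1 * w + q n.+1 * w by ring.
    have -> : t + v * h + (q n.+1 + q n.+1) * h = t + v * h + q n.+1 * h + q n.+1 * h by ring.
    by rewrite /loop_integral; ring.
  move: Tuv; rewrite leNgt => /negP; apply; rewrite E.
  rewrite (_ : eta * q n ^+ 2 = eta * q n.+1 ^+ 2 + eta * q n.+1 ^+ 2 +
    eta * q n.+1 ^+ 2 + eta * q n.+1 ^+ 2); last by rewrite qn; ring.
  apply: (le_lt_trans (ler_normD _ _)); apply: ltrD => //.
  apply: (le_lt_trans (ler_normD _ _)); apply: ltrD => //.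
  by apply: (le_lt_trans (ler_normD _ _)); apply: ltrD.
pose p := fix p n := if n is m.+1 then nxt (m, p m) else (0, 0).
have p_inv n : inv n (p n).
  elim: n => [|n IH]; last by have [] := nxtP (n, p n) IH.
  split; rewrite /= ?lexx ?add0r ?/q ?expr0 ?invr1 ?expr1n ?mulr1 ?lexx//.
  by rewrite /T /= /q expr0 invr1 !mul0r !addr0 !mul1r.
have p_nest n := (nxtP (n, p n) (p_inv n)).2.
have [|||sg sgP] := @nested_intervals (fun n => (p n).1) q.
- by move=> n; rewrite ltW.
- by move=> n; have [] := p_nest n.
- by move=> n; have [] := p_nest n.
have [|||ta taP] := @nested_intervals (fun n => (p n).2) q.
- by move=> n; rewrite ltW.
- by move=> n; have [] := p_nest n.
- by move=> n; have [] := p_nest n.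
have qz : q 0 = 1 by rewrite /q expr0 invr1.
have sg1 : 0 <= sg <= 1 by have := sgP 0; rewrite qz /= add0r.
have ta1 : 0 <= ta <= 1 by have := taP 0; rewrite qz /= add0r.
have [a [b [c [HP HQ]]]] := hPQ _ _ sg1 ta1.
pose N := `|w| + `|h| + 1.
have N0 : 0 < N by rewrite ltr_wpDl// addr_ge0.
have e0 : 0 < eta / (2 * N ^+ 2) by rewrite divr_gt0// mulr_gt0// exprn_gt0.
have [d d0 small] := loop_integral_small A B HP HQ e0.
have [n qn] : exists n, q n < d / N by apply: exists_half_pow_lt; rewrite divr_gt0.
have [u0 u1 v0 v1 Tn] := p_inv n.
set u := (p n).1 in u0 u1; set v := (p n).2 in v0 v1.
have in01 (z l : R) : 0 <= z -> z + q n <= 1 -> 0 <= l <= 1 -> 0 <= z + l * q n <= 1.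
  move=> z0 z1 /andP[l0 l1]; rewrite addr_ge0 ?mulr_ge0 ?(ltW (q0 n))//=.
  by rewrite (le_trans _ z1)// lerD2l ler_piMl// ltW.
have near (z l k : R) : z <= k <= z + q n -> 0 <= l <= 1 -> `|z + l * q n - k| <= q n.
  move=> /andP[zk kz] /andP[l0 l1]; have qn0 := q0 n.
  have lq0 : 0 <= l * q n by rewrite mulr_ge0// ltW.
  have lq1 : l * q n <= q n by rewrite ler_piMl// ltW.
  by rewrite ler_norml; apply/andP; split; lra.
have Nq : N * q n < d by rewrite mulrC -ltr_pdivlMr.
have qn0 := ltW (q0 n).
have cs (x0 z w' l : R) : x0 + z * w' + l * (q n * w') = x0 + (z + l * q n) * w' by ring.
have : `|T n (p n)| <= eta / (2 * N ^+ 2) * (N * q n) ^+ 2.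
  apply: small => //.
  - move=> l l1; rewrite cs (_ : _ - _ = (u + l * q n - sg) * w); last by rewrite /u; ring.
    rewrite normrM mulrC; apply: ler_pM => //; last by apply: near => //; exact: sgP.
    by rewrite /N -addrA lerDl addr_ge0.
  - move=> l l1; rewrite cs (_ : _ - _ = (v + l * q n - ta) * h); last by rewrite /v; ring.
    rewrite normrM mulrC; apply: ler_pM => //; last by apply: near => //; exact: taP.
    by rewrite /N (addrC `|w|) -addrA lerDl addr_ge0.
  - by move=> l m l1 m1; rewrite !cs; apply: dA; apply: in01.
  - by move=> l m l1 m1; rewrite !cs; apply: dB; apply: in01.
move=> /(le_trans Tn); rewrite (_ : _ * (N * q n) ^+ 2 = eta / 2 * q n ^+ 2); last first.
  by field; rewrite gt_eqF.
rewrite ler_pM2r ?exprn_gt0//; lra.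
Qed.

End LoopIntegral.

Section ExactForms.
Variable R : realType.
Implicit Types (P Q F u v : R -> R -> R) (a b c d x y e r z s t l k : R).

(** Integrating along the two paths that follow the sides of a rectangle gives
    the same function since loop integrals vanish; one expression is visibly
    differentiable in y, the other one in x. *)
Lemma closed_form_exact P Q x0 y0 r : 0 < r ->
  (forall x y, `|x - x0| < r -> `|y - y0| < r -> exists a b c,
     affine_approx P x y a b /\ affine_approx Q x y b c) ->
  exists F, forall x y, `|x - x0| < r / 2 -> `|y - y0| < r / 2 ->
    is_derive x 1 (fun z => F z y) (P x y) /\ is_derive y 1 (F x) (Q x y).
Proof.
move=> r0 hPQ; have r2 : r / 2 < r by rewrite ltr_pdivrMr// ltr_pMr// ltr1n.
have r20 : 0 < r / 2 by rewrite divr_gt0.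
have near z z0 : z0 - r / 2 <= z <= z0 + r / 2 -> `|z - z0| < r.
  by move=> /andP[? ?]; rewrite ltr_norml; apply/andP; split; lra.
have near' z z0 : `|z - z0| < r / 2 -> z0 - r / 2 < z < z0 + r / 2.
  by rewrite ltr_norml => /andP[? ?]; apply/andP; split; lra.
have /boolp.choice[A' dA'] : forall y, exists A : R -> R, `|y - y0| < r -> forall x, `|x - x0| < r / 2 ->
    is_derive x 1 A (P x y).
  move=> y; have [yr|?] := pselect (`|y - y0| < r); last by exists (fun=> 0).
  have [|A dA] := @antiderivative R (fun x => P x y) (x0 - r / 2) (x0 + r / 2).
    move=> x /near xr; have [a [b [c [/affine_approx_derive1 H _]]]] := hPQ x y xr yr.
    exact: is_derive_continuous H.
  by exists A => _ x /near'; exact: dA.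
have /boolp.choice[B dB'] : forall x, exists B : R -> R, `|x - x0| < r -> forall y, `|y - y0| < r / 2 ->
    is_derive y 1 B (Q x y).
  move=> x; have [xr|?] := pselect (`|x - x0| < r); last by exists (fun=> 0).
  have [|B dB] := @antiderivative R (Q x) (y0 - r / 2) (y0 + r / 2).
    move=> y /near yr; have [a [b [c [_ /affine_approx_derive2 H]]]] := hPQ x y xr yr.
    exact: is_derive_continuous H.
  by exists B => _ y /near'; exact: dB.
pose A x y := A' y x.
have dA x y : `|x - x0| < r / 2 -> `|y - y0| < r / 2 ->
    is_derive x 1 (fun z => A z y) (P x y).
  by move=> xr yr; apply: dA' => //; exact: lt_trans r2.
have dB x y : `|x - x0| < r / 2 -> `|y - y0| < r / 2 -> is_derive y 1 (B x) (Q x y).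
  by move=> xr yr; apply: dB' => //; exact: lt_trans r2.
have seg z z0 (l : R) : `|z - z0| < r / 2 -> 0 <= l <= 1 -> `|z0 + l * (z - z0) - z0| < r / 2.
  move=> zr /andP[l0 l1]; rewrite addrAC subrr add0r normrM.
  by apply: le_lt_trans zr; rewrite ger0_norm// ler_piMl.
have F0 x y : `|x - x0| < r / 2 -> `|y - y0| < r / 2 ->
    A x y0 - A x0 y0 + (B x y - B x y0) = A x y - A x0 y + (B x0 y - B x0 y0).
  move=> xr yr; have := @loop_integral_eq0 R P Q A B x0 (x - x0) y0 (y - y0).
  have -> : x0 + (x - x0) = x by ring.
  have -> : y0 + (y - y0) = y by ring.
  have H : loop_integral A B x0 x y0 y = 0 ->
    A x y0 - A x0 y0 + (B x y - B x y0) = A x y - A x0 y + (B x0 y - B x0 y0).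
    by rewrite /loop_integral; lra.
  move=> H'; apply/H/H' => l m l1 m1.
  - by apply: hPQ; apply: lt_trans (seg _ _ _ _ _) r2.
  - by apply: dA; exact: seg.
  - by apply: dB; exact: seg.
exists (fun x y => A x y0 - A x0 y0 + (B x y - B x y0)) => x y xr yr; split.
- apply/is_derive_epsP => e e0.
  have /is_derive_epsP/(_ e e0)[d d0 H] := dA x y xr yr.
  exists (Num.min d (r / 2 - `|x - x0|)); first by rewrite lt_min d0 subr_gt0.
  move=> s; rewrite lt_min => /andP[sd sr].
  have sr' : `|s - x0| < r / 2.
    rewrite (_ : s - x0 = (s - x) + (x - x0)); last by ring.
    by rewrite (le_lt_trans (ler_normD _ _))// -ltrBrDr.
  rewrite !F0//; move: (H s sd).
  by congr (`|_| <= _); ring.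
- apply/is_derive_epsP => e e0.
  have /is_derive_epsP/(_ e e0)[d d0 H] := dB x y xr yr.
  exists d => // t /H; by congr (`|_| <= _); ring.
Qed.

Definition jointly_continuous F x y := forall e, 0 < e -> exists2 d, 0 < d &
  forall s t, `|s - x| < d -> `|t - y| < d -> `|F s t - F x y| < e.

Lemma affine_approx_continuous P x y a b :
  affine_approx P x y a b -> jointly_continuous P x y.
Proof.
move=> /(_ 1 ltr01)[d d0 H] e e0.
pose k := `|a| + `|b| + 2.
have k0 : 0 < k by rewrite ltr_wpDl// addr_ge0.
exists (Num.min d (e / k)); first by rewrite lt_min d0 divr_gt0.
move=> s t; rewrite !lt_min => /andP[sd se] /andP[td te].
have := H s t sd td; set X := P s t; set Y := P x y => K.
have -> : X - Y = (X - (Y + a * (s - x) + b * (t - y))) + (a * (s - x) + b * (t - y)) by ring.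
apply: (@le_lt_trans _ _ ((1 * (`|s - x| + `|t - y|)) + (`|a| * `|s - x| + `|b| * `|t - y|))).
  rewrite (le_trans (ler_normD _ _))// lerD// (le_trans (ler_normD _ _))// !normrM//.
apply: (@lt_le_trans _ _ ((1 * (e / k + e / k)) + (`|a| * (e / k) + `|b| * (e / k)))).
  apply: ltr_leD; first by rewrite !mul1r ltrD.
  by rewrite lerD// ler_wpM2l// ltW.
rewrite le_eqVlt (_ : _ + _ = e) ?eqxx// /k.
by field; rewrite -/k gt_eqF.
Qed.

Lemma jointly_continuous_bounded P x y : jointly_continuous P x y ->
  exists M, exists2 d, 0 < d & 0 < M /\
    forall s t, `|s - x| < d -> `|t - y| < d -> `|P s t| <= M.
Proof.
move=> /(_ 1 ltr01)[d d0 H]; exists (`|P x y| + 1), d => //; split.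
  by rewrite ltr_wpDl.
move=> s t sd td; have := H s t sd td.
rewrite -[P s t in X in _ -> X](subrK (P x y)) => /ltW K.
by rewrite (le_trans (ler_normD _ _))// addrC lerD2l.
Qed.

(** Used for the primitive F of a closed form, of which only the partial
    derivatives are known. *)
Lemma continuous_partials_continuous F P Q x y r : 0 < r ->
  (forall s t, `|s - x| < r -> `|t - y| < r ->
    is_derive s 1 (fun z => F z t) (P s t) /\ is_derive t 1 (F s) (Q s t)) ->
  jointly_continuous P x y -> jointly_continuous Q x y -> jointly_continuous F x y.
Proof.
move=> r0 dF /jointly_continuous_bounded[M [d d0 [M0 HM]]].
move=> /jointly_continuous_bounded[N [d' d'0 [N0 HN]]] e e0.
have MN : 0 < M + N by rewrite addr_gt0.
pose D := Num.min (Num.min r (e / (M + N))) (Num.min d d').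
exists D; first by rewrite !lt_min r0 d0 d'0 divr_gt0.
move=> s t; rewrite !lt_min => /andP[/andP[sr se] /andP[sd sd']].
move=> /andP[/andP[tr te] /andP[td td']].
have seg z z0 k (l : R) : `|z - z0| < k -> 0 <= l <= 1 -> `|z0 + l * (z - z0) - z0| < k.
  move=> zr /andP[l0 l1]; rewrite addrAC subrr add0r normrM.
  by apply: le_lt_trans zr; rewrite ger0_norm// ler_piMl.
have [l l1 E1] := @mvt_segment R (fun z => F z t) (fun z => P z t) x s
  (fun l hl => (dF _ _ (seg _ _ _ _ sr hl) tr).1).
have y0 k : 0 < k -> `|x - x| < k by rewrite subrr normr0.
have [m m1 E2] := @mvt_segment R (F x) (Q x) y t
  (fun l hl => (dF _ _ (y0 _ r0) (seg _ _ _ _ tr hl)).2).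
have -> : F s t - F x y = (F s t - F x t) + (F x t - F x y) by ring.
rewrite E1 E2 (le_lt_trans (ler_normD _ _))// !normrM.
apply: (@lt_le_trans _ _ (M * (e / (M + N)) + N * (e / (M + N)))); last first.
  by rewrite -mulrDl mulrC divfK// gt_eqF.
apply: ltr_leD.
  apply: (@le_lt_trans _ _ (M * `|s - x|)); last by rewrite ltr_pM2l.
  by rewrite ler_wpM2r// HM// seg.
apply: ler_pM => //; last exact: ltW.
by rewrite HN ?y0// seg.
Qed.

(** If p > 0, then g is increasing at c from the value 0, so f increases on the
    right of c. *)
Lemma second_derivative_at_max (f g : R -> R) c d p : 0 < d ->
  (forall z, `|z - c| < d -> is_derive z 1 f (g z)) -> is_derive c 1 g p ->
  (forall z, `|z - c| < d -> f z <= f c) -> p <= 0.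
Proof.
move=> d0 df dg fmax; rewrite leNgt; apply/negP => p0.
have near z : (z \in `]c - d, c + d[%R) = (`|z - c| < d).
  by rewrite in_itv /= ltr_norml; apply/idP/idP => /andP[? ?]; apply/andP; split; lra.
have gc : g c = 0.
  have dc : is_derive c 1 f 0.
    apply: (@derive1_at_max R f (c - d) (c + d)).
    - by rewrite lerD2l ge0_cp// ltW.
    - by move=> t; rewrite near => /df[].
    - by rewrite near subrr normr0.
    - by move=> t; rewrite near; exact: fmax.
  have := df c; rewrite subrr normr0 => /(_ d0) dc'.
  by rewrite -(@derive_val _ _ _ _ _ _ _ dc') (@derive_val _ _ _ _ _ _ _ dc).
have /is_derive_epsP/(_ (p / 2))[|d' d'0 H] := dg; first by rewrite divr_gt0.
pose k := Num.min d d' / 2.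
have [k0 kd kd'] : [/\ 0 < k, k < d & k < d'].
  have m0 : 0 < Num.min d d' by rewrite lt_min d0.
  have km : k < Num.min d d' by rewrite ltr_pdivrMr// ltr_pMr// ltr1n.
  by split; [rewrite divr_gt0|rewrite (lt_le_trans km)// ge_min lexx ?orbT..].
have gpos z : c <= z <= c + k -> p / 2 * (z - c) <= g z.
  move=> /andP[cz zk]; have zc : `|z - c| < d'.
    by rewrite ger0_norm ?subr_ge0//; lra.
  have := H z zc; rewrite gc subr0 (ger0_norm (_ : 0 <= z - c)) ?subr_ge0//.
  by rewrite ler_norml => /andP[+ _]; lra.
have inc s t : c <= s -> s <= t -> t <= c + k ->
    exists2 z, s <= z <= t & f t - f s = g z * (t - s).
  move=> cs st tk.
  have [|l /andP[l0 l1] E] := @mvt_segment R f g s t.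
    move=> l /andP[l0 l1]; apply: df.
    have : 0 <= l * (t - s) <= t - s by rewrite mulr_ge0 ?ler_piMl ?subr_ge0.
    by move=> /andP[? ?]; rewrite ger0_norm; lra.
  exists (s + l * (t - s)) => //.
  have : 0 <= l * (t - s) <= t - s by rewrite mulr_ge0 ?ler_piMl ?subr_ge0.
  by move=> /andP[? ?]; apply/andP; split; lra.
have [|||z /andP[z1 z2] E] := @inc c (c + k / 2); [lra..|].
have [|||z' /andP[z'1 z'2] E'] := @inc (c + k / 2) (c + k); [lra..|].
have := fmax (c + k); rewrite addrAC subrr add0r gtr0_norm// => /(_ kd).
apply/negP; rewrite -ltNge -subr_gt0.
have -> : f (c + k) - f c = (f (c + k) - f (c + k / 2)) + (f (c + k / 2) - f c) by ring.
rewrite E E' ltr_wpDr//.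
  apply: mulr_ge0; last by lra.
  by apply: le_trans (gpos _ _); [rewrite mulr_ge0//; lra|apply/andP; split; lra].
apply: mulr_gt0; last by lra.
apply: lt_le_trans (gpos _ _); [rewrite mulr_gt0//; lra|apply/andP; split; lra].
Qed.

End ExactForms.

(** * Harmonic functions have no strict paraboloid maximum *)

Lemma is_derive_translate (R : realType) (f : R -> R) (x h k : R) :
  is_derive (x + h) 1 f k -> is_derive x 1 (fun z => f (z + h)) k.
Proof.
move=> /is_derive_epsP H; apply/is_derive_epsP => e /H[d d0 {}H].
exists d => // s sx; have := H (s + h).
by rewrite opprD addrACA subrr addr0 => /(_ sx).
Qed.

Lemma derive1_add (R : realType) (f g : R -> R) (x a b : R) :
  is_derive x 1 f a -> is_derive x 1 g b ->
  is_derive x 1 (fun z => f z + g z) (a + b).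
Proof. by move=> df dg; exact: is_deriveD. Qed.

Lemma derive1_sub (R : realType) (f g : R -> R) (x a b : R) :
  is_derive x 1 f a -> is_derive x 1 g b ->
  is_derive x 1 (fun z => f z - g z) (a - b).
Proof. by move=> df dg; exact: is_deriveB. Qed.

Section LocalMaximum.
Variable R : realType.
Implicit Types (P Q F u v : R -> R -> R) (a b c d x y e r z s t l k h : R).

Lemma square_max F x0 y0 r : 0 <= r ->
  (forall x y, `|x - x0| <= r -> `|y - y0| <= r -> jointly_continuous F x y) ->
  exists x1 y1, [/\ `|x1 - x0| <= r, `|y1 - y0| <= r &
    forall x y, `|x - x0| <= r -> `|y - y0| <= r -> F x y <= F x1 y1].
Proof.
move=> r0 cF.
pose K := `[x0 - r, x0 + r]%classic `*` `[y0 - r, y0 + r]%classic : set (R * R).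
have inK x y : K (x, y) <-> `|x - x0| <= r /\ `|y - y0| <= r.
  rewrite /K /= !in_itv /= !ler_norml.
  split; last first.
    by move=> [/andP[? ?] /andP[? ?]]; split; apply/andP; split; lra.
  by move=> [/andP[? ?] /andP[? ?]]; split; apply/andP; split; lra.
have cK : compact K by apply: compact_setX; exact: segment_compact.
have [||[x1 y1] /set_mem/inK[x1r y1r] max] :=
    @compact_EVT_max _ R (fun p : R * R => F p.1 p.2) K _ cK _.
- by exists (x0, y0); apply/inK; rewrite !subrr normr0.
- apply: continuous_in_subspaceT => -[x y] /set_mem/inK[xr yr].
  apply/cvgrPdist_lt => e /(cF x y xr yr)[d d0 H].
  exists (ball x d, ball y d); first by split; exact: nbhsx_ballx.
  move=> [s t] [/= sx ty].
  by rewrite distrC; apply: H; rewrite distrC.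
exists x1, y1; split => // x y xr yr.
by apply: (max (x, y)); apply/mem_set/inK.
Qed.

(** The hypothesis is that u + iv satisfies the Cauchy-Riemann equations in the
    sense of differentiability.  Let F be a primitive of u dx - v dy.  The
    difference D(x, y) = F(x + h, y) - F(x, y) has second derivatives with sum
    zero, so adding k times the squared distance to the centre makes an
    interior maximum impossible.  But D(x, y) / h is a value of u at distance
    at most h from (x, y); if u decreased like a paraboloid, then for small h
    the perturbed difference would be larger at the centre than on the edge of
    a square. *)
Lemma harmonic_no_paraboloid_max u v x0 y0 r e : 0 < r -> 0 < e ->
  (forall x y, `|x - x0| < r -> `|y - y0| < r -> exists a b,
     affine_approx u x y a b /\ affine_approx v x y (- b) a) ->
  ~ (forall x y, `|x - x0| < r -> `|y - y0| < r ->
      u x y <= u x0 y0 - e * ((x - x0) ^+ 2 + (y - y0) ^+ 2)).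
Proof.
move=> r0 e0 CR umax.
have neg_approx x y a b : affine_approx v x y (- b) a ->
    affine_approx (fun s t => - v s t) x y b (- a).
  move=> H e' /H[d d0 {}H]; exists d => // s t sd td.
  rewrite -normrN; move: (H s t sd td); congr (`|_| <= _); ring.
have [|F dF] := @closed_form_exact R u (fun s t => - v s t) x0 y0 r r0.
  move=> x y xr yr; have [a [b [Hu Hv]]] := CR x y xr yr.
  by exists a, b, (- a); split => //; exact: neg_approx.
pose p := r / 4.
have p0 : 0 < p by rewrite divr_gt0.
have pr : p < r / 2 by rewrite /p; lra.
have cF x y : `|x - x0| < r / 2 -> `|y - y0| < r / 2 -> jointly_continuous F x y.
  move=> xr yr.
  have [||a [b [Hu Hv]]] := CR x y; [lra..|].
  pose q := Num.min (r / 2 - `|x - x0|) (r / 2 - `|y - y0|).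
  apply: (@continuous_partials_continuous R F u (fun s t => - v s t) x y q).
  - by rewrite /q lt_min !subr_gt0 xr.
  - move=> s t; rewrite !lt_min => /andP[sx _] /andP[_ ty]; apply: dF.
      rewrite (_ : s - x0 = (s - x) + (x - x0)); last by ring.
      by rewrite (le_lt_trans (ler_normD _ _))// -ltrBrDr.
    rewrite (_ : t - y0 = (t - y) + (y - y0)); last by ring.
    by rewrite (le_lt_trans (ler_normD _ _))// -ltrBrDr.
  - exact: affine_approx_continuous Hu.
  - exact: affine_approx_continuous (neg_approx _ _ _ _ Hv).
have zr : `|x0 - x0| < r by rewrite subrr normr0.
have zr' : `|y0 - y0| < r by rewrite subrr normr0.
have [a0 [b0 [/affine_approx_continuous cu _]]] := CR x0 y0 zr zr'.
(* On the edge of the square of half-side p, the value of u at a point moved by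
   at most p / 2 is below the central one by at least e p^2 / 4.  Of this drop,
   e p^2 / 16 is spent on continuity at the centre and e p^2 / 8 on the
   perturbation k. *)
have [|d d0 ud] := cu (e * p ^+ 2 / 16); first by rewrite divr_gt0// mulr_gt0// exprn_gt0.
pose h := Num.min d p / 2.
have [h0 hd hp] : [/\ 0 < h, h < d & h <= p / 2].
  have m0 : 0 < Num.min d p by rewrite lt_min d0.
  have md : Num.min d p <= d by rewrite ge_min lexx.
  have mp : Num.min d p <= p by rewrite ge_min lexx orbT.
  by rewrite /h; split; lra.
have shift x : `|x - x0| <= p -> `|x + h - x0| < r / 2.
  move=> xp; rewrite (_ : x + h - x0 = (x - x0) + h); last by ring.
  rewrite (le_lt_trans (ler_normD _ _))// (gtr0_norm h0).
  by move: xp hp; rewrite /p; lra.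
have diff x y : `|x - x0| <= p -> `|y - y0| <= p ->
    exists2 l, 0 <= l <= h & F (x + h) y - F x y = u (x + l) y * h.
  move=> xp yp.
  have [|l /andP[l0 l1] E] := @mvt_segment R (fun z => F z y) (fun z => u z y) x (x + h).
    move=> l /andP[l0 l1]; apply: (dF _ _ _ _).1; last exact: le_lt_trans pr.
    rewrite (_ : x + h - x = h); last by ring.
    have lh : 0 <= l * h <= h by rewrite mulr_ge0 ?ler_piMl ?(ltW h0).
    rewrite (_ : _ - x0 = (x - x0) + l * h); last by ring.
    rewrite (le_lt_trans (ler_normD _ _))// [`|l * h|]ger0_norm; last by case/andP: lh.
    by case/andP: lh; move: xp; rewrite /p; move: hp; rewrite /p; lra.
  move: E; rewrite (_ : x + h - x = h); last by ring.
  move=> E.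
  by exists (l * h) => //; rewrite mulr_ge0 ?ler_piMl ?(ltW h0).
have [k kE] : exists k, k = h * e / 16 by exists (h * e / 16).
have k0 : 0 < k by rewrite kE divr_gt0// mulr_gt0.
pose E x y := F (x + h) y - F x y + k * ((x - x0) ^+ 2 + (y - y0) ^+ 2).
have cE x y : `|x - x0| <= p -> `|y - y0| <= p -> jointly_continuous E x y.
  move=> xp yp e' e'0.
  have e'3 : 0 < e' / 3 by rewrite divr_gt0.
  have yr := le_lt_trans yp pr.
  have [d1 d10 H1] := cF _ _ (shift _ xp) yr _ e'3.
  have [d2 d20 H2] := cF _ _ (le_lt_trans xp pr) yr _ e'3.
  have [d3 d30 H3] : exists2 d3, 0 < d3 & forall s t, `|s - x| < d3 -> `|t - y| < d3 ->
     `|k * ((s - x0) ^+ 2 + (t - y0) ^+ 2) - k * ((x - x0) ^+ 2 + (y - y0) ^+ 2)| < e' / 3.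
    apply: (@affine_approx_continuous R (fun s t => k * ((s - x0) ^+ 2 + (t - y0) ^+ 2)) x y
       (k * (2 * (x - x0))) (k * (2 * (y - y0)))) => // e2 e20.
    exists (e2 / k); first by rewrite divr_gt0.
    move=> s t; rewrite !ltr_pdivlMr// => sx ty.
    rewrite [X in `|X| <= _](_ : _ = k * (s - x) * (s - x) + k * (t - y) * (t - y)); last by ring.
    rewrite (le_trans (ler_normD _ _))// 4!normrM (gtr0_norm k0) mulrDr lerD//.
      by rewrite ler_wpM2r// mulrC ltW.
    by rewrite ler_wpM2r// mulrC ltW.
  exists (Num.min d1 (Num.min d2 d3)); first by rewrite !lt_min d10 d20.
  move=> s t; rewrite !lt_min => /and3P[s1 s2 s3] /and3P[t1 t2 t3].
  have -> : E s t - E x y = (F (s + h) t - F (x + h) y) - (F s t - F x y) +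
     (k * ((s - x0) ^+ 2 + (t - y0) ^+ 2) - k * ((x - x0) ^+ 2 + (y - y0) ^+ 2)).
    by rewrite /E; ring.
  rewrite (le_lt_trans (ler_normD _ _))//.
  have -> : e' = e' / 3 + e' / 3 + e' / 3 by field.
  rewrite ltrD ?H3// (le_lt_trans (ler_normB _ _))// ltrD ?H2// H1//.
  by rewrite opprD addrACA subrr addr0.
have [x1 [y1 [x1p y1p Emax]]] := square_max (ltW p0) cE.
have center : h * u x0 y0 - h * (e * p ^+ 2 / 16) < E x0 y0.
  have [||l /andP[l0 lh] El] := diff x0 y0; [by rewrite subrr normr0 ltW..|].
  rewrite /E !subrr expr0n /= addr0 mulr0 addr0 El -mulrBr mulrC ltr_pM2r//.
  have := ud (x0 + l) y0; rewrite addrAC !subrr add0r normr0 ger0_norm// => /(_ _ d0).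
  by rewrite ltr_norml => /(_ (le_lt_trans lh hd))/andP[+ _]; lra.
have edge x y : `|x - x0| <= p -> `|y - y0| <= p -> `|x - x0| = p \/ `|y - y0| = p ->
    E x y <= h * u x0 y0 - h * (e * p ^+ 2 / 16) - h * (e * p ^+ 2 / 16).
  move=> xp yp xyp; have [l /andP[l0 lh] El] := diff x y xp yp.
  have xl : `|x + l - x0| < r.
    rewrite (_ : x + l - x0 = (x - x0) + l); last by ring.
    rewrite (le_lt_trans (ler_normD _ _))// (ger0_norm l0).
    by move: xp hp; rewrite /p; lra.
  have yr : `|y - y0| < r by move: yp; rewrite /p; lra.
  have far : p ^+ 2 / 4 <= (x + l - x0) ^+ 2 + (y - y0) ^+ 2.
    have p4 : p ^+ 2 / 4 = (p / 2) ^+ 2 by field.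
    case: xyp => [xE|yE]; last first.
      rewrite -[(y - y0) ^+ 2]real_normK ?num_real// yE.
      have := sqr_ge0 (x + l - x0); have := sqr_ge0 p; lra.
    have : p / 2 <= `|x + l - x0|.
      have := ler_normB (x + l - x0) l; rewrite (_ : x + l - x0 - l = x - x0); last by ring.
      by rewrite xE (ger0_norm l0); lra.
    rewrite p4 -[(x + l - x0) ^+ 2]real_normK ?num_real// => H.
    apply: (@le_trans _ _ (`|x + l - x0| ^+ 2)); last by rewrite lerDl sqr_ge0.
    by rewrite lerXn2r// nnegrE// ltW// divr_gt0.
  have ul := umax _ _ xl yr.
  have xs : (x - x0) ^+ 2 <= p ^+ 2.
    by rewrite -[(x - x0) ^+ 2]real_normK ?num_real// lerXn2r// nnegrE// ltW.
  have ys : (y - y0) ^+ 2 <= p ^+ 2.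
    by rewrite -[(y - y0) ^+ 2]real_normK ?num_real// lerXn2r// nnegrE// ltW.
  rewrite /E El.
  have H1 : k * ((x - x0) ^+ 2 + (y - y0) ^+ 2) <= h * (e * p ^+ 2 / 8).
    rewrite (_ : h * (e * p ^+ 2 / 8) = k * (p ^+ 2 + p ^+ 2)); last by rewrite kE; field.
    by rewrite ler_pM2l// lerD.
  have H2 : u (x + l) y * h <= h * (u x0 y0 - e * (p ^+ 2 / 4)).
    rewrite mulrC ler_pM2l// (le_trans ul)// lerB// ler_pM2l//.
  move: H1 H2; rewrite mulrBr; set X := h * u x0 y0.
  have -> : h * (e * p ^+ 2 / 8) = h * (e * p ^+ 2 / 16) * 2 by field.
  have -> : h * (e * (p ^+ 2 / 4)) = h * (e * p ^+ 2 / 16) * 4 by field.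
  by lra.
have small : 0 < h * (e * p ^+ 2 / 16) by rewrite mulr_gt0// divr_gt0// mulr_gt0// exprn_gt0.
have z0p z : `|z - z| <= p by rewrite subrr normr0 ltW.
have inner : `|x1 - x0| < p /\ `|y1 - y0| < p.
  have Ec := Emax _ _ (z0p x0) (z0p y0).
  split; rewrite lt_neqAle ?x1p ?y1p andbT; apply/eqP => H.
    by have := edge _ _ x1p y1p (or_introl H); lra.
  by have := edge _ _ x1p y1p (or_intror H); lra.
have [x1p' y1p'] := inner.
have near z z1 z0 q : `|z1 - z0| < q -> `|z - z1| < q - `|z1 - z0| -> `|z - z0| <= q.
  move=> H1 H2; rewrite (_ : z - z0 = (z - z1) + (z1 - z0)); last by ring.
  by rewrite (le_trans (ler_normD _ _))// -lerBrDr ltW.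
have [||a [b [Hu Hv]]] := CR x1 y1; [by rewrite /p in x1p y1p *; lra..|].
have [||a' [b' [Hu' Hv']]] := CR (x1 + h) y1.
- by have := shift _ x1p; lra.
- by rewrite /p in y1p *; lra.
have Dsq z0 z : is_derive z 1 (fun z : R => k * (z - z0) ^+ 2) (k * (2 * (z - z0))).
  apply/is_derive_epsP => e2 e20; exists (e2 / k); first by rewrite divr_gt0.
  move=> s; rewrite ltr_pdivlMr// => sx.
  rewrite [X in `|X| <= _](_ : _ = k * (s - z) * (s - z)); last by ring.
  by rewrite 2!normrM (gtr0_norm k0) ler_wpM2r// mulrC ltW.
have lin z0 z : is_derive z 1 (fun z : R => k * (2 * (z - z0))) (k * 2).
  apply/is_derive_epsP => e2 e20; exists 1 => // s _.
  rewrite [X in `|X| <= _](_ : _ = 0); last by ring.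
  by rewrite normr0 mulr_ge0// ltW.
(* The second derivatives of the perturbed difference E in x and in y are both
   nonpositive at its maximum, whereas their sum is 4 k. *)
have x_test : a' - a + k * 2 <= 0.
  apply: (@second_derivative_at_max R (fun z => E z y1)
    (fun z => u (z + h) y1 - u z y1 + k * (2 * (z - x0))) x1 (p - `|x1 - x0|)).
  - by rewrite subr_gt0.
  - move=> z zx1; have zp := near _ _ _ _ x1p' zx1.
    have [dF1 _] := dF _ _ (shift _ zp) (le_lt_trans y1p pr).
    have [dF2 _] := dF _ _ (le_lt_trans zp pr) (le_lt_trans y1p pr).
    rewrite (_ : (fun z => _) = (fun z => F (z + h) y1 - F z y1 + (k * (z - x0) ^+ 2 + k * (y1 - y0) ^+ 2))).
      apply: derive1_add; first by apply: derive1_sub => //; exact: is_derive_translate dF1.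
      rewrite -[X in is_derive _ _ _ X]addr0.
      exact: derive1_add.
    by apply/funext => s; rewrite /E mulrDr.
  - apply: derive1_add.
    apply: derive1_sub; last exact: affine_approx_derive1 Hu.
    exact: (is_derive_translate (affine_approx_derive1 Hu')).
  - by move=> z zx1; apply: Emax => //; exact: near zx1.
have y_test : (- a') - (- a) + k * 2 <= 0.
  apply: (@second_derivative_at_max R (E x1)
    (fun z => - v (x1 + h) z - (- v x1 z) + k * (2 * (z - y0))) y1 (p - `|y1 - y0|)).
  - by rewrite subr_gt0.
  - move=> z zy1; have zp := near _ _ _ _ y1p' zy1.
    have [_ dF1] := dF _ _ (shift _ x1p) (le_lt_trans zp pr).
    have [_ dF2] := dF _ _ (le_lt_trans x1p pr) (le_lt_trans zp pr).
    rewrite (_ : E x1 = (fun z => F (x1 + h) z - F x1 z + (k * (x1 - x0) ^+ 2 + k * (z - y0) ^+ 2))).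
      apply: derive1_add.
      rewrite -[X in is_derive _ _ _ X]add0r.
      exact: derive1_add.
    by apply/funext => s; rewrite /E mulrDr.
  - apply: derive1_add.
    apply: derive1_sub; last exact: affine_approx_derive2 (neg_approx _ _ _ _ Hv).
    exact: affine_approx_derive2 (neg_approx _ _ _ _ Hv').
  - by move=> z zy1; apply: Emax => //; exact: near zy1.
lra.
Qed.

End LocalMaximum.

(** * Topology of the plane and of the sphere *)

Section ComplexPlane.
Variable R : realType.
Local Notation C := (Cplx R).
Local Notation Re := (@complex.Re R).
Local Notation Im := (@complex.Im R).
Implicit Types (z w : C) (A K V : set C).

Lemma norm_normc z : `|z| = (normc z)%:C%C.
Proof. by case: z. Qed.

Lemma normc_ge0 z : 0 <= normc z.
Proof. by case: z => x y; exact: sqrtr_ge0. Qed.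

Lemma normc_eq0 z : (normc z == 0) = (z == 0).
Proof.
apply/eqP/eqP => [/eq0_normc//|->]; exact: normc0.
Qed.

Lemma normc_gt0 z : (0 < normc z) = (z != 0).
Proof. by rewrite lt_def normc_ge0 andbT normc_eq0. Qed.

Lemma normc_triangle z w : normc (z + w) <= normc z + normc w.
Proof. exact: le_normcD. Qed.

Lemma normcB z w : normc (z - w) = normc (w - z).
Proof. by rewrite -normcN opprB. Qed.

Lemma normc_Re z : `|Re z| <= normc z.
Proof.
case: z => x y /=; rewrite -sqrtr_sqr ler_sqrt ?lerDl ?sqr_ge0//.
by rewrite addr_ge0 ?sqr_ge0.
Qed.

Lemma normc_Im z : `|Im z| <= normc z.
Proof.
case: z => x y /=; rewrite -sqrtr_sqr ler_sqrt ?lerDr ?sqr_ge0//.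
by rewrite addr_ge0 ?sqr_ge0.
Qed.

Lemma normc_le_ReIm z : normc z <= `|Re z| + `|Im z|.
Proof.
case: z => x y /=; have xy0 : 0 <= `|x| + `|y| by rewrite addr_ge0.
rewrite -[leRHS](ger0_norm xy0) -[leRHS]sqrtr_sqr ler_sqrt ?sqr_ge0// sqrrD !real_normK ?num_real//.
by rewrite lerD2r lerDl mulrn_wge0// mulr_ge0.
Qed.

Lemma nbhs_normcP z A : nbhs z A <->
  exists2 e : R, 0 < e & forall w, normc (w - z) < e -> A w.
Proof.
split.
  move=> /nbhs_ballP[[e1 e2] /=]; rewrite ltcE /= => /andP[/eqP -> e0] H.
  exists e1 => // w wz; apply: H.
  by rewrite /ball /= distrC norm_normc ltcR.
move=> [e e0 H]; apply/nbhs_ballP; exists (e%:C)%C => /=; first by rewrite ltcR.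
by move=> w; rewrite /ball /= distrC norm_normc ltcR => /H.
Qed.

Definition disc z (e : R) : set C := [set w | normc (w - z) < e].

Lemma nbhs_disc z e : 0 < e -> nbhs z (disc z e).
Proof. by move=> e0; apply/nbhs_normcP; exists e. Qed.

Lemma disc_open z e : open (disc z e).
Proof.
rewrite openE => w wz; apply/nbhs_normcP.
exists (e - normc (w - z)); first by rewrite subr_gt0.
move=> s; rewrite ltrBrDr /disc /= => H.
rewrite (_ : s - z = (s - w) + (w - z)); last by rewrite addrA subrK.
exact: le_lt_trans (normc_triangle _ _) H.
Qed.

Lemma open_normcP A : open A <->
  forall z, A z -> exists2 e : R, 0 < e & disc z e `<=` A.
Proof.
rewrite openE; split=> H z /H.
  by move/nbhs_normcP => [e e0 zA]; exists e.
by move=> [e e0 zA]; apply/nbhs_normcP; exists e.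
Qed.

Lemma continuous_complex : continuous (fun p : R * R => (p.1 +i* p.2)%C : C).
Proof.
move=> [x y] A /nbhs_normcP[e e0 H]; rewrite /nbhs /=.
exists (ball x (e / 2), ball y (e / 2)).
  by split; apply: nbhsx_ballx; rewrite divr_gt0.
move=> [s t] [/= xs yt]; apply: H.
apply: (le_lt_trans (normc_le_ReIm _)) => /=.
by rewrite [e]splitr; apply: ltrD; rewrite distrC.
Qed.

Lemma bounded_closed_compactC A (M : R) :
  closed A -> (forall z, A z -> normc z <= M) -> compact A.
Proof.
move=> cA AM.
pose K := `[- M, M]%classic `*` `[- M, M]%classic : set (R * R).
have cK : compact K by apply: compact_setX; exact: segment_compact.
have := @continuous_compact _ _ (fun p : R * R => (p.1 +i* p.2)%C : C) K
  (continuous_subspaceT continuous_complex) cK.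
move=> cK2; apply: (subclosed_compact cA cK2) => z /AM zM; exists (Re z, Im z) => /=.
  by rewrite /K /= !in_itv /= -!ler_norml !(le_trans _ zM) ?normc_Re ?normc_Im.
by case: (z).
Qed.

Definition segment z w : set C := [set z + (t%:C)%C * (w - z) | t in `[0, 1]%classic].

Lemma segment_connectedC z w : connected (segment z w).
Proof.
apply: connected_continuous_connected; first exact: segment_connected.
apply: continuous_subspaceT => t A /nbhs_normcP[e e0 H].
have k0 : 0 < normc (w - z) + 1 by rewrite ltr_wpDl ?normc_ge0.
apply/nbhs_ballP; exists (e / (normc (w - z) + 1)); first by rewrite /= divr_gt0.
move=> s; rewrite /ball /= distrC => st; apply: H.
have -> : z + (s%:C)%C * (w - z) - (z + (t%:C)%C * (w - z)) = ((s - t)%:C)%C * (w - z).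
  by rewrite rmorphB /=; ring.
rewrite normcM /= expr0n /= addr0 sqrtr_sqr.
apply: (@le_lt_trans _ _ (`|s - t| * (normc (w - z) + 1))).
  by rewrite ler_wpM2l// lerDl.
by rewrite -ltr_pdivlMr.
Qed.

Lemma segment_left z w : segment z w z.
Proof. by exists 0; rewrite /= ?mul0r ?addr0// in_itv /= lexx ler01. Qed.

Lemma segment_right z w : segment z w w.
Proof. by exists 1; rewrite /= ?mul1r ?subrKC// in_itv /= lexx ler01. Qed.

Definition convexC A := forall z w, A z -> A w -> segment z w `<=` A.

Lemma convex_connected A : convexC A -> connected A.
Proof.
move=> cA; have [->|/set0P[z Az]] := eqVneq A set0; first exact: connected0.
rewrite (_ : A = \bigcup_(w in A) segment z w).
  apply: bigcup_connected; last by move=> *; exact: segment_connectedC.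
  by exists z => w _; exact: segment_left.
apply/seteqP; split => [w Aw|w [s As] /(cA _ _ Az As)//].
by exists w => //; exact: segment_right.
Qed.

Lemma convex_disc z e : convexC (disc z e).
Proof.
move=> a b az bz s [t t01 <-]; move: t01; rewrite /= in_itv /= => /andP[t0 t1].
rewrite /disc /=.
have -> : a + (t%:C)%C * (b - a) - z = ((1 - t)%:C)%C * (a - z) + (t%:C)%C * (b - z).
  by rewrite rmorphB rmorph1; ring.
apply: (le_lt_trans (normc_triangle _ _)); rewrite !normcM /= expr0n /= !addr0 !sqrtr_sqr.
rewrite (ger0_norm t0) (ger0_norm (_ : 0 <= 1 - t)) ?subr_ge0//.
have [->|tN0] := eqVneq t 0; first by rewrite subr0 mul1r mul0r addr0.
have tp : 0 < t by rewrite lt_def tN0.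
rewrite [e](_ : _ = (1 - t) * e + t * e); last by ring.
apply: ler_ltD; last by rewrite ltr_pM2l.
by rewrite ler_wpM2l ?subr_ge0// ltW.
Qed.

(** Uniform positive distance from a compact set to the complement of an open
    neighbourhood. *)
Lemma compact_open_margin K V : compact K -> open V -> K `<=` V ->
  exists2 d : R, 0 < d & forall z, K z -> disc z d `<=` V.
Proof.
move=> cK /open_normcP oV KV.
have : \forall d \near (0 : R)^'+, K `<=` (fun z => disc z d `<=` V).
  move/compact_near_coveringP : cK; apply => z /KV /oV[e e0 zV].
  exists (disc z (e / 2), [set d | d < e / 2]) => /=.
    split; first by apply: nbhs_disc; rewrite divr_gt0.
    by apply: nbhs_right_lt; rewrite divr_gt0.
  move=> [w d] [/= wz de] s sw; apply: zV; rewrite /disc /=.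
  rewrite (_ : s - z = (s - w) + (w - z)); last by rewrite addrA subrK.
  rewrite (le_lt_trans (normc_triangle _ _))// [e]splitr ltrD//.
  exact: lt_trans de.
move=> H; near (0 : R)^'+ => d; exists d; first by [].
by near: d.
Unshelve. all: by end_near. Qed.

Lemma closed_normc_le (M : R) : closed [set z : C | normc z <= M].
Proof.
rewrite -openC; apply/open_normcP => z /negP; rewrite -ltNge => Mz.
exists (normc z - M); first by rewrite subr_gt0.
move=> w wz; apply/negP; rewrite -ltNge.
have := normc_triangle (z - w) w; rewrite subrK normcB.
by move: wz; rewrite /disc /=; lra.
Qed.

Lemma compact_bounded_normc K : compact K ->
  exists M : R, forall z, K z -> normc z <= M.
Proof.
move=> cK.
have : \forall M \near (+oo : set_system R), K `<=` (fun z => normc z <= M).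
  move/compact_near_coveringP : cK; apply => z Kz.
  exists (disc z 1, [set M | normc z + 1 <= M]) => /=.
    by split; [exact: nbhs_disc|apply: nbhs_pinfty_ge; exact: num_real].
  move=> [w M] [/= wz zM]; apply: le_trans zM.
  rewrite -[w in X in X <= _](subrK z) addrC.
  by rewrite (le_trans (normc_triangle _ _))// lerD2l ltW.
by move=> [M [_ H]]; exists (M + 1); apply: H; rewrite ltrDl.
Qed.

End ComplexPlane.

Section Sphere.
Variable R : realType.
Local Notation C := (Cplx R).

(** Neighbourhoods of infinity are defined by compact sets; in the plane these
    are controlled by the modulus. *)
Lemma nbhs_inftyP (A : set (sphere R)) : nbhs (infty : sphere R) A <->
  A infty /\ exists M : R, forall w : C, M < normc w -> A (Some w).
Proof.
split.
  move=> [K [cK clK] /= KA]; split; first by apply: KA; right.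
  have [M KM] := compact_bounded_normc cK.
  exists M => w Mw; apply: KA; left; exists w => //= Kw.
  by have := KM w Kw; rewrite leNgt Mw.
move=> [A0 [M AM]]; exists [set z : C | normc z <= M].
  have cl := @closed_normc_le R M.
  by split => //; apply: (@bounded_closed_compactC R _ M).
move=> [w|] /=; last by [].
by move=> [|//] [z /negP]; rewrite -ltNge => Mz [<-]; exact: AM.
Qed.

End Sphere.

(** * The maximum modulus principle *)

Section MaximumModulus.
Variable R : realType.
Local Notation C := (Cplx R).
Local Notation Re := (@complex.Re R).
Local Notation Im := (@complex.Im R).
Implicit Types (z w : C) (A K V X G : set C) (g h : C -> C).

Definition cderivative h z (d : C) := forall e : R, 0 < e -> exists2 r : R, 0 < r &
  forall s, normc (s - z) < r -> normc (h s - h z - d * (s - z)) <= e * normc (s - z).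

Lemma derivable_cderivative h z : derivable h z 1 -> exists d, cderivative h z d.
Proof.
move=> /cvg_ex[d hd]; exists d => e e0.
have /hd : nbhs d (disc d e) by exact: nbhs_disc.
rewrite /= nbhs_simpl /= => /nbhs_normcP[r r0 H]; exists r => // s sz.
have [->|sNz] := eqVneq s z.
  by rewrite !subrr mulr0 subr0 normc0 mulr0.
have s0 : s - z != 0 by rewrite subr_eq0.
have := H (s - z); rewrite subr0 => /(_ sz s0); rewrite /disc /= /shift /=.
rewrite [_ *: 1]mulr1 subrK.
have -> : h s - h z - d * (s - z) = ((s - z)^-1 *: (h s - h z) - d) * (s - z).
  by rewrite mulrBl [_ *: _]mulrC divfK.
by rewrite normcM => /ltW ?; rewrite ler_wpM2r ?normc_ge0.
Qed.

Lemma cderivative_derivable h z d : cderivative h z d -> derivable h z 1.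
Proof.
move=> hd; apply/cvg_ex; exists d => A /nbhs_normcP[e e0 dA].
have e20 : 0 < e / 2 by rewrite divr_gt0.
have [r r0 H] := hd _ e20.
suff : nbhs (0 : C) (fun t : C => t != 0 -> A (t^-1 *: ((h \o shift z) (t *: 1) - h z))) by [].
apply/nbhs_normcP; exists r => // t; rewrite subr0 => tr t0; apply: dA.
rewrite /= [_ *: 1]mulr1.
have := H (t + z); rewrite addrK => /(_ tr).
set D := h (t + z) - h z; rewrite (_ : _ *: D - d = (D - d * t) * t^-1); last first.
  by rewrite mulrBl mulfK// [_ *: _]mulrC.
rewrite normcM normcV => Dt.
have nt0 : 0 < normc t by rewrite normc_gt0.
rewrite -(@ltr_pM2r _ (normc t))// mulfVK ?gt_eqF//; apply: le_lt_trans Dt _.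
by rewrite ltr_pM2r// ltr_pdivrMr// ltr_pMr// ltr1n.
Qed.

Lemma continuous_normcP h z : {for z, continuous h} <->
  forall e : R, 0 < e -> exists2 r : R, 0 < r &
    forall s, normc (s - z) < r -> normc (h s - h z) < e.
Proof.
split.
  move=> ch e e0; have /ch : nbhs (h z) (disc (h z) e) by exact: nbhs_disc.
  by move=> /nbhs_normcP[r r0 H]; exists r.
move=> H A /nbhs_normcP[e /H[r r0 {}H] hA]; apply/nbhs_normcP; exists r => //.
by move=> w /H /hA.
Qed.

Lemma cderivative_continuous h z d : cderivative h z d -> {for z, continuous h}.
Proof.
move=> /(_ 1 ltr01)[r r0 H]; apply/continuous_normcP => e e0.
have k0 : 0 < 1 + normc d by rewrite ltr_pwDl ?normc_ge0.
exists (Num.min r (e / (1 + normc d))); first by rewrite lt_min r0 divr_gt0.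
move=> s; rewrite lt_min => /andP[/H sr]; rewrite ltr_pdivlMr// => se.
rewrite (_ : h s - h z = (h s - h z - d * (s - z)) + d * (s - z)); last by rewrite subrK.
rewrite (le_lt_trans (normc_triangle _ _))//; apply: le_lt_trans se.
by rewrite [leRHS]mulrDr mulr1 normcM [_ * normc d]mulrC lerD2r -[leRHS]mul1r.
Qed.

Lemma cderivativeD h g z (a b : C) :
  cderivative h z a -> cderivative g z b -> cderivative (fun w => h w + g w) z (a + b).
Proof.
move=> dh dg e e0; have e20 : 0 < e / 2 by rewrite divr_gt0.
have [r r0 H] := dh _ e20; have [r' r'0 H'] := dg _ e20.
exists (Num.min r r'); first by rewrite lt_min r0.
move=> s; rewrite lt_min => /andP[/H {}H /H' {}H'].
rewrite [X in normc X <= _](_ : _ = (h s - h z - a * (s - z)) + (g s - g z - b * (s - z))); last by ring.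
by rewrite (le_trans (normc_triangle _ _))// [e]splitr mulrDl lerD.
Qed.

Lemma cderivative_comp h g z (a b : C) :
  cderivative h z a -> cderivative g (h z) b -> cderivative (g \o h) z (b * a).
Proof.
move=> dh dg e e0.
have /continuous_normcP ch := cderivative_continuous dh.
have a0 : 0 < normc a + 1 by rewrite ltr_wpDl ?normc_ge0.
have b0 : 0 < normc b + 1 by rewrite ltr_wpDl ?normc_ge0.
have [|r1 r10 H1] := dg (e / 2 / (normc a + 1)); first by rewrite !divr_gt0.
have [r2 r20 H2] := ch _ r10.
have [|r3 r30 H3] := dh (Num.min 1 (e / 2 / (normc b + 1))).
  by rewrite lt_min ltr01 !divr_gt0.
exists (Num.min r2 r3); first by rewrite lt_min r20.
move=> s; rewrite lt_min => /andP[/H2/H1 {}H1 /H3 {}H3].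
set n := normc (s - z) in H3 *; have n0 : 0 <= n := normc_ge0 _.
set D := h s - h z in H1 H3.
have DB : normc D <= (normc a + 1) * n.
  rewrite [D](_ : _ = (D - a * (s - z)) + a * (s - z)); last by rewrite subrK.
  rewrite (le_trans (normc_triangle _ _))// normcM mulrDl mul1r addrC lerD//.
  by apply: (le_trans H3); rewrite -[leRHS]mul1r ler_wpM2r// ge_min lexx.
rewrite [X in normc X <= _](_ : _ = (g (h s) - g (h z) - b * D) + b * (D - a * (s - z))) /=; last by ring.
rewrite (le_trans (normc_triangle _ _))// [e]splitr mulrDl lerD//.
  apply: (le_trans H1).
  have -> : e / 2 * n = e / 2 / (normc a + 1) * ((normc a + 1) * n).
    by rewrite mulrA divfK// gt_eqF.
  by rewrite ler_wpM2l// !divr_ge0 ?ltW.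
have -> : e / 2 * n = (normc b + 1) * (e / 2 / (normc b + 1) * n).
  by rewrite mulrA [_ * (_ / _)]mulrC divfK// gt_eqF.
rewrite normcM; apply: ler_pM; rewrite ?normc_ge0 ?lerDl//.
by apply: (le_trans H3); rewrite ler_wpM2r// ge_min lexx orbT.
Qed.

Lemma cderivative_affine z (a b : C) : cderivative (fun w => a * (w - b)) z a.
Proof.
move=> e e0; exists 1 => // s _.
rewrite [X in normc X <= _](_ : _ = 0); last by ring.
by rewrite normc0 mulr_ge0 ?normc_ge0 ?ltW.
Qed.

Lemma cderivativeM_cst h z (a b : C) :
  cderivative h z a -> cderivative (fun w => b * h w) z (b * a).
Proof.
move=> dh e e0; have k0 : 0 < 1 + normc b by rewrite ltr_pwDl ?normc_ge0.
have [|r r0 H] := dh (e / (1 + normc b)); first by rewrite divr_gt0.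
exists r => // s /H {}H.
rewrite [X in normc X <= _](_ : _ = b * (h s - h z - a * (s - z))); last by ring.
rewrite normcM; apply: (@le_trans _ _ ((1 + normc b) * (e / (1 + normc b) * normc (s - z)))).
  by apply: ler_pM => //; rewrite ?normc_ge0// lerDr.
by rewrite mulrA mulrCA divff ?gt_eqF// mulr1.
Qed.

(** The real and imaginary parts are differentiable as functions of two real
    variables, with coefficients related by the Cauchy-Riemann equations. *)
Lemma cderivative_affine_approx h z d : cderivative h z d ->
  affine_approx (fun x y => Re (h (x +i* y)%C)) (Re z) (Im z) (Re d) (- Im d) /\
  affine_approx (fun x y => Im (h (x +i* y)%C)) (Re z) (Im z) (Im d) (Re d).
Proof.
case: z d => [z1 z2] [d1 d2] /= H.
have K e : 0 < e -> exists2 r, 0 < r & forall s t, `|s - z1| < r -> `|t - z2| < r ->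
    normc (h (s +i* t)%C - h (z1 +i* z2)%C - (d1 +i* d2)%C * ((s - z1) +i* (t - z2))%C) <=
    e * (`|s - z1| + `|t - z2|).
  move=> e0; have [r r0 {}H] := H _ e0; exists (r / 2); first by rewrite divr_gt0.
  move=> s t sr tr; have le := @normc_le_ReIm R ((s - z1) +i* (t - z2))%C.
  apply: (@le_trans _ _ (e * normc ((s - z1) +i* (t - z2))%C)).
    by apply: (H (s +i* t)%C); rewrite (le_lt_trans le)//= [r]splitr ltrD.
  by rewrite ler_wpM2l// ltW.
split=> e /K[r r0 {}K]; exists r => // s t sr tr; apply: le_trans (K s t sr tr).
- apply: le_trans (normc_Re _).
  case: (h _) (h _) => [a1 a2] [b1 b2] /=.
  by rewrite le_eqVlt; apply/orP; left; apply/eqP; congr (`|_|); ring.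
- apply: le_trans (normc_Im _).
  case: (h _) (h _) => [a1 a2] [b1 b2] /=.
  by rewrite le_eqVlt; apply/orP; left; apply/eqP; congr (`|_|); ring.
Qed.

Lemma normc_sqr z : normc z ^+ 2 = Re z ^+ 2 + Im z ^+ 2.
Proof. by case: z => x y /=; rewrite sqr_sqrtr// addr_ge0 ?sqr_ge0. Qed.

Lemma compact_max (K : set C) (f : C -> R) : compact K -> K !=set0 ->
  (forall z, K z -> forall e, 0 < e -> exists2 r : R, 0 < r &
    forall s, normc (s - z) < r -> `|f s - f z| < e) ->
  exists2 q, K q & forall z, K z -> f z <= f q.
Proof.
move=> cK K0 cf.
have [|q /set_mem Kq H] := @compact_EVT_max _ R f K K0 cK.
  apply: continuous_in_subspaceT => z /set_mem Kz.
  move=> A /nbhs_ballP[e /= /(cf z Kz)[r r0 H] fA].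
  apply/nbhs_normcP; exists r => // w /H wz.
  by apply: fA; rewrite /ball /= distrC.
by exists q => // z Kz; apply: H; exact/mem_set.
Qed.

(** If Re g were larger at p than on X minus G, then so would be
    Re g + e |z - p|^2 for small e, whose maximum would be attained at some q
    in G.  Up to a constant, |z - p|^2 is |z - q|^2 plus the real part of an
    affine function c (z - q).  Absorbing this affine function into g gives a
    strict paraboloid maximum at q, excluded by [harmonic_no_paraboloid_max]. *)
Lemma re_maximum_principle X G g : compact X -> open G -> G `<=` X ->
  (forall z, X z -> {for z, continuous g}) ->
  (forall z, G z -> exists d, cderivative g z d) ->
  forall p, X p -> exists q, [/\ X q, ~ G q & Re (g p) <= Re (g q)].
Proof.
move=> cX oG GX cg dg p Xp; apply: contrapT => H.
have lt q : X q -> ~ G q -> Re (g q) < Re (g p).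
  by move=> Xq Gq; rewrite ltNge; apply/negP => ?; apply: H; exists q.
have cRe z : X z -> forall e, 0 < e -> exists2 r : R, 0 < r &
    forall s, normc (s - z) < r -> `|Re (g s) - Re (g z)| < e.
  move=> /cg/continuous_normcP cgz e /cgz[r r0 {}H]; exists r => // s /H.
  by apply: le_lt_trans; rewrite -raddfB; exact: normc_Re.
have cdist z : forall e, 0 < e -> exists2 r : R, 0 < r &
    forall s, normc (s - z) < r -> `|normc (s - p) - normc (z - p)| < e.
  move=> e e0; exists e => // s; apply: le_lt_trans.
  have := normc_triangle (s - z) (z - p); have := normc_triangle (z - s) (s - p).
  rewrite !addrA !subrK (normcB z s) => H1 H2.
  by rewrite ler_norml; apply/andP; split; lra.
have [m mp mX] : exists2 m, m < Re (g p) & forall q, X q -> ~ G q -> Re (g q) <= m.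
  have [Y0|Y0] := eqVneq (X `\` G) set0.
    exists (Re (g p) - 1); first by lra.
    by move=> q Xq Gq; have : (X `\` G) q by []; rewrite Y0.
  have cY : compact (X `\` G).
    apply: (@subclosed_compact _ (X `\` G) X _ cX); last by apply: subDsetl.
    apply: closedI; last exact: open_closedC.
    by apply: compact_closed cX; exact: norm_hausdorff.
  have [||q [Xq Gq] Hq] := @compact_max _ (fun z => Re (g z)) cY.
  - exact/set0P.
  - by move=> z [/cRe].
  by exists (Re (g q)); [exact: lt|move=> s Xs Gs; exact: Hq].
have X0 : X !=set0 by exists p.
have [b Xb Hb] := @compact_max _ (fun z => normc (z - p)) cX X0 (fun z _ => @cdist z).
set M := normc (b - p) in Hb.
have M0 : 0 <= M := normc_ge0 _.
pose k := 2 * (M ^+ 2 + 1).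
have k0 : 0 < k by rewrite mulr_gt0// ltr_wpDl// sqr_ge0.
pose e := (Re (g p) - m) / k.
have e0 : 0 < e by rewrite divr_gt0// subr_gt0.
have [|q Xq Hq] := @compact_max _ (fun z => Re (g z) + e * normc (z - p) ^+ 2) cX X0.
  move=> z Xz e' e'0.
  have e'2 : 0 < e' / 2 by rewrite divr_gt0.
  have [r r0 H1] := cRe z Xz _ e'2.
  pose n := normc (z - p).
  have n0 : 0 <= n := normc_ge0 _.
  have k'0 : 0 < e * (2 * n + 1) by rewrite mulr_gt0// ltr_wpDl// mulr_ge0.
  have [r' r'0 H2] : exists2 r : R, 0 < r & forall s, normc (s - z) < r ->
      `|normc (s - p) - n| < Num.min 1 (e' / 2 / (e * (2 * n + 1))).
    by apply: cdist; rewrite lt_min ltr01 divr_gt0.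
  exists (Num.min r r'); first by rewrite lt_min r0.
  move=> s; rewrite lt_min => /andP[/H1 {}H1 /H2]; rewrite lt_min => /andP[n1 {}H2].
  rewrite -/n; set n' := normc (s - p) in n1 H2 *.
  have -> : Re (g s) + e * n' ^+ 2 - (Re (g z) + e * n ^+ 2) =
     (Re (g s) - Re (g z)) + (n' - n) * (e * (n' + n)) by ring.
  rewrite (le_lt_trans (ler_normD _ _))// [e']splitr ltrD//.
  move: H2; rewrite ltr_pdivlMr// => H2; apply: le_lt_trans H2.
  rewrite normrM ler_wpM2l// normrM (gtr0_norm e0) ler_pM2l//.
  have n'0 : 0 <= n' := normc_ge0 _.
  rewrite ger0_norm ?addr_ge0//; move: n1; rewrite ltr_norml => /andP[_]; lra.
have qG : G q.
  apply: contrapT => Gq; have := Hq _ Xp; rewrite subrr normc0 expr0n /= mulr0 addr0.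
  apply/negP; rewrite -ltNge.
  have := mX q Xq Gq; have : e * normc (q - p) ^+ 2 <= e * M ^+ 2.
    by rewrite ler_pM2l// lerXn2r ?nnegrE ?normc_ge0//; exact: Hb.
  have : e * M ^+ 2 <= (Re (g p) - m) / 2.
    have : e * k = Re (g p) - m by rewrite divfK// gt_eqF.
    by rewrite /k; move: e0; set n := M ^+ 2; lra.
  lra.
have [r r0 qr] := (open_normcP _).1 oG _ qG.
have r20 : 0 < r / 2 by rewrite divr_gt0.
(* This is 2 e conj(q - p). *)
pose c := ((2 * e * (Re q - Re p)) +i* (- (2 * e * (Im q - Im p))))%C : C.
pose g' w := g w + c * (w - q).
have boxG x y : `|x - Re q| < r / 2 -> `|y - Im q| < r / 2 -> G (x +i* y)%C.
  move=> xr yr; apply: qr; rewrite /disc /= [r]splitr.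
  apply: le_lt_trans (normc_le_ReIm _) _.
  by move: xr yr; case: (q) => q1 q2 /= xr yr; exact: ltrD.
apply: (@harmonic_no_paraboloid_max R (fun x y => Re (g' (x +i* y)%C))
  (fun x y => Im (g' (x +i* y)%C)) (Re q) (Im q) (r / 2) e r20 e0).
  move=> x y xr yr; have [d dgz] := dg _ (boxG x y xr yr).
  have := cderivative_affine_approx (cderivativeD dgz (@cderivative_affine _ c q)).
  by exists (Re (d + c)), (- Im (d + c)); rewrite opprK.
move=> x y xr yr; have := Hq _ (GX _ (boxG x y xr yr)).
rewrite /g'; move: (g _) => gz.
rewrite (_ : (Re q +i* Im q)%C = q); last by case: (q).
rewrite subrr mulr0 addr0 !normc_sqr !raddfD /= /c.
case: (q) (p) (g _) gz => [q1 q2] [p1 p2] [h1 h2] [gz1 gz2] /=.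
move=> H'; rewrite -subr_ge0; move: H'; rewrite -subr_ge0.
by congr (0 <= _); ring.
Qed.

Lemma continuous_scale (c : C) g z :
  {for z, continuous g} -> {for z, continuous (fun w => c * g w : C)}.
Proof.
move=> /continuous_normcP cgz; apply/continuous_normcP => e e0.
have k0 : 0 < normc c + 1 by rewrite ltr_wpDl ?normc_ge0.
have [|r r0 H] := cgz (e / (normc c + 1)); first by rewrite divr_gt0.
exists r => // s /H; rewrite ltr_pdivlMr// => lt_e.
rewrite -mulrBr normcM mulrC.
by apply: le_lt_trans lt_e; rewrite ler_wpM2l ?normc_ge0// lerDl.
Qed.

(** Multiplying g by the conjugate of g(p) makes the value at p real and
    nonnegative, so the principle for real parts applies. *)
Theorem maximum_modulus_principle X G g : compact X -> open G -> G `<=` X ->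
  (forall z, X z -> {for z, continuous g}) ->
  (forall z, G z -> exists d, cderivative g z d) ->
  forall p, X p -> exists q, [/\ X q, ~ G q & normc (g p) <= normc (g q)].
Proof.
move=> cX oG GX cg dg p Xp; have [c cE] : exists c : C, c = ((g p)^*)%C by exists ((g p)^*)%C.
have [|z Gz|q [Xq Gq H]] := @re_maximum_principle X G (fun z => c * g z) cX oG GX _ _ p Xp.
- by move=> z /cg; exact: continuous_scale.
- have [d dz] := dg z Gz; exists (c * d); exact: cderivativeM_cst.
exists q; split => //.
have [gp0|gpN0] := eqVneq (g p) 0; first by rewrite gp0 normc0 normc_ge0.
have E : Re (c * g p) = normc (g p) ^+ 2.
  by rewrite normc_sqr cE; case: (g p) => a b /=; ring.
have cn : normc c = normc (g p).
  by rewrite cE; case: (g p) => a b /=; rewrite sqrrN.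
move: H; rewrite E => /le_trans/(_ (ler_norm _)) /le_trans/(_ (normc_Re _)).
by rewrite normcM cn expr2 ler_pM2l ?normc_gt0.
Qed.

End MaximumModulus.

(** * A connected part of the boundary lies on one side of a compact set *)

Lemma connected_locally_constant (T : topologicalType) (A : set T) (g : T -> bool) :
  connected A -> (forall x, A x -> \forall y \near x, A y -> g y = g x) ->
  forall x y, A x -> A y -> g x = g y.
Proof.
move=> cA lc x y Ax Ay.
have op b : exists2 U : set T, open U & A `&` [set z | g z = b] = A `&` U.
  exists ([set z | A z -> g z = b]^°); first exact: open_interior.
  apply/seteqP; split=> z [Az /=].
    by move=> <-; split=> //; exact: lc.
  by move=> /interior_subset/(_ Az).
have [U oU AU] := op (g x); have [U' oU' AU'] := op (~~ g x).
suff /seteqP[_ /(_ y Ay)[_ /= ->//]] : A `&` [set z | g z = g x] = A.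
apply: cA; first by exists x.
  by exists U.
exists (~` U'); first exact: open_closedC.
apply/seteqP; split=> z [Az /=] => [gz|nU'z]; split=> //.
  move=> U'z; have : (A `&` U') z by [].
  by rewrite -AU' => -[_ /=]; rewrite gz; case: (g x).
have [//|gz] := eqVneq (g z) (g x); case: nU'z.
suff : (A `&` U') z by case.
by rewrite -AU'; split=> //=; move: gz; case: (g z); case: (g x).
Qed.

(** Two copies of V and two copies of the complement of K, glued over V minus K
    identically on O and crosswise on O', form a two-sheeted cover of the
    plane.  It is handled without constructing the total space: every disc of
    radius d lies in a chart, so the cover is determined by the transition of
    sheets along short steps. *)

Section PlaneCover.
Variable R : realType.
Local Notation C := (Cplx R).
Local Notation Re := (@complex.Re R).
Local Notation Im := (@complex.Im R).
Variables (V K O O' : set C) (d : R).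
Hypotheses (oV : open V) (cV : connected V) (cK : compact K)
  (oO : open O) (oO' : open O') (OO' : O `&` O' = set0) (VK : V `\` K = O `|` O')
  (d0 : 0 < d)
  (chart : forall z : C, disc z d `<=` V \/ disc z d `&` K = set0).
Implicit Types (z w : C) (a b : nat -> C).

Definition sheet z : bool := `[< O' z >].

Lemma sheet_segment z w : segment z w `<=` V -> segment z w `&` K = set0 ->
  sheet z = sheet w.
Proof.
move=> sV sK; apply: (@connected_locally_constant _ (segment z w)).
- exact: segment_connectedC.
- move=> x sx; have : (O `|` O') x.
    by rewrite -VK; split; [exact: sV|move=> Kx; have : (segment z w `&` K) x by []; rewrite sK].
  case=> [Ox|O'x].
    have := open_nbhs_nbhs (conj oO Ox); apply: filterS => y Oy _.
    rewrite /sheet !asboolF// => O'y.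
      by have : (O `&` O') x by []; rewrite OO'.
    by have : (O `&` O') y by []; rewrite OO'.
  have := open_nbhs_nbhs (conj oO' O'x); apply: filterS => y O'y _.
  by rewrite /sheet !asboolT.
- exact: segment_left.
- exact: segment_right.
Qed.

(** Change of sheet along a short step from z to w, where the sheets over a
    point of V are numbered in the chart V and those over any other point in
    the complement of K.  The step is made in a chart that contains the disc
    around z; if that chart is the complement of K, then the numbers in V have
    to be translated at both ends. *)
Definition transition z w : bool :=
  if `[< disc z d `<=` V >] then false else sheet z (+) sheet w.

Lemma transition_zz z : transition z z = false.
Proof. by rewrite /transition addbb; case: ifP. Qed.

Lemma disc_center z : disc z d z.
Proof. by rewrite /disc /= subrr normc0. Qed.

(** Charts containing a common disc agree: a step whose disc lies in V and which
    avoids K stays in one of O and O' ([sheet_segment]). *)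
Lemma transition_inner c z w : disc c d `<=` V -> disc c d z -> disc c d w ->
  normc (w - z) < d -> transition z w = false.
Proof.
move=> cdV cz cw zw; rewrite /transition; case: asboolP => // nzV.
have [//|zK] := chart z.
rewrite (@sheet_segment z w) ?addbb//.
  by apply: subset_trans cdV; exact: convex_disc.
apply: subsetI_eq0 zK => //; apply: convex_disc => //; exact: disc_center.
Qed.

Lemma transition_outer c z w : disc c d `&` K = set0 -> disc c d z -> disc c d w ->
  normc (w - z) < d -> transition z w = sheet z (+) sheet w.
Proof.
move=> cdK cz cw zw; rewrite /transition; case: asboolP => // zV.
rewrite (@sheet_segment z w) ?addbb//.
  by apply: subset_trans zV; apply: convex_disc => //; exact: disc_center.
by apply: subsetI_eq0 cdK => //; exact: convex_disc.
Qed.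

Lemma transition_sym z w : normc (w - z) < d -> transition z w = transition w z.
Proof.
move=> zw; have wz : normc (z - w) < d by rewrite normcB.
have [zV|zK] := chart z.
  by rewrite !(@transition_inner z)//; exact: disc_center.
by rewrite !(@transition_outer z) ?[sheet w (+) _]addbC//; exact: disc_center.
Qed.

(** Transitions along a small quadrilateral cancel, because the whole
    quadrilateral lies in one chart. *)
Lemma transition_cycle c z w z' w' :
  disc c d z -> disc c d w -> disc c d z' -> disc c d w' ->
  normc (w - z) < d -> normc (w' - w) < d -> normc (z' - z) < d -> normc (w' - z') < d ->
  transition z w (+) transition w w' = transition z z' (+) transition z' w'.
Proof.
move=> cz cw cz' cw' zw ww' zz' z'w'; have [cV'|cK'] := chart c.
  by rewrite !(@transition_inner c).
rewrite !(@transition_outer c)//.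
by case: (sheet z) (sheet w) (sheet z') (sheet w') => [] [] [] [].
Qed.

Fixpoint transport a n : bool :=
  if n is m.+1 then transport a m (+) transition (a m) (a m.+1) else false.

(** Two polygonal paths that stay close to one another bound a ladder of small
    quadrilaterals, so their transports differ only by the end steps. *)
Lemma transport_homotopic a b n (r : R) : 2 * r <= d ->
  (forall k, (k < n)%N -> normc (a k.+1 - a k) < r) ->
  (forall k, (k < n)%N -> normc (b k.+1 - b k) < r) ->
  (forall k, (k <= n)%N -> normc (b k - a k) < r) ->
  transport a n (+) transition (a n) (b n) = transition (a 0) (b 0) (+) transport b n.
Proof.
move=> rd; elim: n => [|n IH] aS bS ab; first by rewrite /= addbF.
have {}IH := IH (fun k kn => aS k (ltnW kn)) (fun k kn => bS k (ltnW kn))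
  (fun k kn => ab k (leqW kn)).
have a1 := aS n (ltnSn n); have b1 := bS n (ltnSn n).
have ab0 := ab n (leqnSn n); have ab1 := ab n.+1 (leqnn _).
have r0 : 0 < r := le_lt_trans (normc_ge0 _) a1.
have rd' : r < d by lra.
have near x : normc (x - a n) < 2 * r -> disc (a n) d x.
  by move=> H; apply: lt_le_trans rd.
have b1n : normc (b n.+1 - a n) < 2 * r.
  rewrite (_ : _ - _ = (b n.+1 - b n) + (b n - a n)); last by rewrite addrA subrK.
  by rewrite (le_lt_trans (normc_triangle _ _))// mulr_natl mulr2n ltrD.
have lt2 x : x < r -> x < 2 * r by move=> ?; lra.
rewrite /= -addbA (@transition_cycle (a n) _ _ (b n)).
- by rewrite addbA IH addbA.
- exact: disc_center.
- exact/near/lt2.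
- exact/near/lt2.
- exact: near.
- exact: lt_trans rd'.
- exact: lt_trans rd'.
- exact: lt_trans rd'.
- exact: lt_trans rd'.
Qed.

Definition ray n z (k : nat) : C := ((k%:R / n%:R : R)%:C)%C * z.

Lemma normc_real (x : R) : normc (x%:C)%C = `|x|.
Proof. by rewrite /= expr0n /= addr0 sqrtr_sqr. Qed.

Lemma ray_step n z k : (0 < n)%N -> normc (ray n z k.+1 - ray n z k) = normc z / n%:R.
Proof.
move=> n0; rewrite /ray -mulrBl -rmorphB normcM normc_real.
have -> : k.+1%:R / n%:R - k%:R / n%:R = n%:R^-1 :> R.
  by rewrite -mulrBl -natrB// subSnn mul1r.
by rewrite ger0_norm ?invr_ge0// mulrC.
Qed.

Lemma ray_end n z : (0 < n)%N -> ray n z n = z.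
Proof.
by move=> n0; rewrite /ray divff ?mul1r// pnatr_eq0 -lt0n.
Qed.

Lemma ray_start n z : ray n z 0 = 0.
Proof. by rewrite /ray !mul0r. Qed.

Let r := d / 2.
Let r0 : 0 < r. Proof. by rewrite divr_gt0. Qed.
Let rld : r < d. Proof. by rewrite /r ltr_pdivrMr// ltr_pMr// ltr1n. Qed.
Let rd : 2 * r <= d. Proof. by rewrite mulrC divfK. Qed.

Lemma transport_ray_near n z w : (0 < n)%N -> normc z / n%:R < r -> normc w / n%:R < r ->
  normc (w - z) < r ->
  transport (ray n w) n = transport (ray n z) n (+) transition z w.
Proof.
move=> n0 zn wn zw.
have := @transport_homotopic (ray n z) (ray n w) n r rd _ _ _.
rewrite !ray_start !ray_end// transition_zz addFb => -> //.
- by move=> k _; rewrite ray_step.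
- by move=> k _; rewrite ray_step.
- move=> k kn; rewrite /ray -mulrBr normcM normc_real.
  apply: le_lt_trans zw; rewrite ler_piMl ?normc_ge0// ger0_norm ?divr_ge0//.
  by rewrite ler_pdivrMr ?ltr0n// mul1r ler_nat.
Qed.

Lemma transport_rayS n z : (0 < n)%N -> normc z / n%:R < r ->
  transport (ray n.+1 z) n.+1 = transport (ray n z) n.
Proof.
move=> n0 zn.
have zn1 : normc z / n.+1%:R < r.
  by apply: le_lt_trans zn; rewrite ler_wpM2l ?normc_ge0// lef_pV2 ?posrE ?ltr0n// ler_nat.
have := @transport_homotopic (ray n z) (ray n.+1 z) n r rd _ _ _.
rewrite !ray_start ray_end// transition_zz addFb => E.
rewrite [LHS]/= -E ?ray_end//; first last.
- move=> k kn; rewrite /ray -mulrBl -rmorphB normcM normc_real.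
  apply: le_lt_trans zn1; rewrite mulrC ler_wpM2l ?normc_ge0//.
  have -> : k%:R / n.+1%:R - k%:R / n%:R = - (k%:R / n%:R / n.+1%:R) :> R.
    by rewrite -natr1; field; rewrite ?natr1 !pnatr_eq0 /= -?lt0n ?n0.
  rewrite normrN ger0_norm ?divr_ge0// ler_piMl ?invr_ge0//.
  by rewrite ler_pdivrMr ?ltr0n// mul1r ler_nat.
- by move=> k _; rewrite ray_step.
- by move=> k _; rewrite ray_step.
rewrite -addbA (@transition_sym z) ?addbb ?addbF//.
have := ray_step z n (ltn0Sn n); rewrite ray_end// normcB => ->.
exact: lt_trans zn1 rld.
Qed.

(** The plane is star-shaped: transporting a sheet from 0 to z along the radius,
    in steps shorter than r, defines a section.  The number of steps depends on
    the modulus of z, and by [section_ray] any larger number gives the same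
    sheet. *)
Definition section z : bool :=
  let n := (Num.truncn (normc z / r)).+1 in transport (ray n z) n.

Lemma section_ray z n : normc z / r < n%:R -> section z = transport (ray n z) n.
Proof.
have zr0 : 0 <= normc z / r by rewrite divr_ge0 ?normc_ge0// ltW.
set m := (Num.truncn (normc z / r)).+1.
have zm : normc z / r < m%:R by exact: truncnS_gt.
move=> zn; have mn : (m <= n)%N.
  by rewrite truncn_lt_nat.
rewrite /section -/m -(subnKC mn); elim: (n - m)%N => [|k ->]; first by rewrite addn0.
rewrite addnS transport_rayS//.
rewrite ltr_pdivrMr ?ltr0n// mulrC -ltr_pdivrMr//.
by apply: lt_le_trans zm _; rewrite ler_nat leq_addr.
Qed.

Lemma section_near z w : normc (w - z) < r ->
  section w = section z (+) transition z w.
Proof.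
move=> zw; pose n := maxn (Num.truncn (normc z / r)).+1 (Num.truncn (normc w / r)).+1.
have lt x : (Num.truncn (normc x / r) < n)%N -> normc x / r < n%:R.
  by move=> H; apply: lt_le_trans (truncnS_gt _) _; rewrite ler_nat.
have zn : normc z / r < n%:R by apply: lt; rewrite leq_maxl.
have wn : normc w / r < n%:R by apply: lt; rewrite leq_maxr.
have n0 : (0 < n)%N by rewrite leq_max.
rewrite (section_ray zn) (section_ray wn); apply: transport_ray_near => //.
  by rewrite ltr_pdivrMr ?ltr0n// mulrC -ltr_pdivrMr.
by rewrite ltr_pdivrMr ?ltr0n// mulrC -ltr_pdivrMr.
Qed.

Lemma section_locally_constant z : V z -> \forall w \near z, section w = section z.
Proof.
move=> Vz; have [e e0 zV] := (open_normcP _).1 oV _ Vz.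
apply/nbhs_normcP; exists (Num.min e r); first by rewrite lt_min e0 r0.
move=> w; rewrite lt_min => /andP[we wr]; rewrite (section_near wr).
rewrite /transition; case: asboolP => [|nzV]; first by rewrite addbF.
have [//|zK] := chart z.
rewrite (@sheet_segment z w) ?addbb ?addbF//.
  apply: subset_trans zV; apply: convex_disc => //.
  by rewrite /disc /= subrr normc0.
apply: subsetI_eq0 zK => //; apply: convex_disc; first exact: disc_center.
exact: lt_trans wr rld.
Qed.

Lemma section_constant z w : V z -> V w -> section z = section w.
Proof.
apply: connected_locally_constant => // x /section_locally_constant.
by apply: filterS.
Qed.

(** The same section, read in the chart that is the complement of K. *)
Definition outer_section z : bool := section z (+) sheet z.

Lemma outer_section_locally_constant z : ~ K z ->
  \forall w \near z, outer_section w = outer_section z.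
Proof.
move=> Kz; have oK : open (~` K).
  by apply: closed_openC; apply: compact_closed cK; exact: norm_hausdorff.
have [e e0 zK] := (open_normcP _).1 oK _ Kz.
apply/nbhs_normcP; exists (Num.min e r); first by rewrite lt_min e0 r0.
move=> w; rewrite lt_min => /andP[we wr].
have wd : normc (w - z) < d.
  exact: lt_trans wr rld.
rewrite /outer_section (section_near wr).
rewrite /transition; case: asboolP => [zV|_]; last first.
  by case: (section z) (sheet z) (sheet w) => [] [] [].
rewrite addbF (@sheet_segment z w)//.
  by apply: subset_trans zV; apply: convex_disc => //; exact: disc_center.
apply/disjoints_subset; apply: subset_trans zK; apply: convex_disc => //.
by rewrite /disc /= subrr normc0.
Qed.

Definition outside_square (M : R) : set C := [set z | M < `|Re z| \/ M < `|Im z|].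

(** The outside of a square is a union of four half-planes, each of which meets
    the next one.  Connectedness near infinity is what extends the section to
    the sphere. *)
Lemma outside_square_connected M : 0 <= M -> connected (outside_square M).
Proof.
move=> M0.
have hp (f : C -> R) : (forall z w (t : R), f (z + (t%:C)%C * (w - z)) = f z + t * (f w - f z)) ->
    connected [set z : C | M < f z].
  move=> lin; apply: convex_connected => z w /= Mz Mw s [t t01 <-].
  move: t01; rewrite /= in_itv /= => /andP[t0 t1]; rewrite lin.
  have [->|tN1] := eqVneq t 1; first by rewrite mul1r subrKC.
  have tlt : 0 < 1 - t by rewrite subr_gt0 lt_neqAle tN1.
  rewrite (_ : f z + _ = (1 - t) * f z + t * f w); last by ring.
  rewrite [M](_ : _ = (1 - t) * M + t * M); last by ring.
  by rewrite ltr_leD// ?ltr_pM2l// ler_wpM2l// ltW.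
have H1 : connected [set z : C | M < Re z].
  by apply: hp => -[z1 z2] [w1 w2] t /=; ring.
have H2 : connected [set z : C | M < - Re z].
  by apply: (hp (fun z => - Re z)) => -[z1 z2] [w1 w2] t /=; ring.
have H3 : connected [set z : C | M < Im z].
  by apply: hp => -[z1 z2] [w1 w2] t /=; ring.
have H4 : connected [set z : C | M < - Im z].
  by apply: (hp (fun z => - Im z)) => -[z1 z2] [w1 w2] t /=; ring.
have -> : outside_square M = ([set z : C | M < Re z] `|` [set z : C | M < Im z]) `|`
    ([set z : C | M < - Re z] `|` [set z : C | M < - Im z]).
  apply/seteqP; split => z; rewrite /outside_square /= !ltr_normr.
    by move=> [/orP[]|/orP[]]; tauto.
  by move=> [[]|[]] ->; rewrite ?orbT; [left|right|left|right].
apply: connectedU; [|apply: connectedU => //|apply: connectedU => //].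
- by exists ((- (M + 1)) +i* (M + 1))%C; split; [right|left] => /=; lra.
- by exists ((M + 1) +i* (M + 1))%C; split => /=; lra.
- by exists ((- (M + 1)) +i* (- (M + 1)))%C; split => /=; lra.
Qed.

(** The section is constant on V, and so is its reading in the complement of K
    on beta.  The two readings agree on O and differ on O', so beta cannot be
    adherent to both. *)
Lemma boundary_continuum_one_side (beta : set (sphere R)) p p' :
  connected beta -> beta `&` in_sphere V = set0 -> K `<=` V ->
  beta p -> closure (in_sphere O) p -> beta p' -> closure (in_sphere O') p' -> False.
Proof.
move=> cbeta bV KV bp Op bp' Op'.
have [M M0 KM] : exists2 M : R, 0 <= M & forall z, K z -> normc z <= M.
  have [M KM] := compact_bounded_normc cK.
  by exists (Num.max 0 M) => [|z /KM zM]; rewrite le_max ?lexx ?zM ?orbT.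
have farK z : outside_square M z -> ~ K z.
  move=> + /KM Kz; case; rewrite ltNge => /negP; apply; apply: le_trans Kz.
    exact: normc_Re.
  exact: normc_Im.
have far z w : outside_square M z -> outside_square M w -> outer_section z = outer_section w.
  apply: connected_locally_constant; first exact: outside_square_connected.
  move=> x /farK/outer_section_locally_constant; exact: filterS.
pose g (q : sphere R) := if q is Some z then outer_section z
   else outer_section ((M + 1) +i* 0)%C.
have lc q : beta q -> \forall y \near q, g y = g q.
  case: q => [z|] bq.
    have Kz : ~ K z.
      by move=> /KV Vz; have : (beta `&` in_sphere V) (Some z);
        [by split => //; exists z|rewrite bV].
    exact: outer_section_locally_constant.
  apply/nbhs_inftyP; split => //; exists (M + M) => w Mw; apply: far.
    rewrite /outside_square /=; have := normc_le_ReIm w.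
    have [?|ReM] := ltP M `|Re w|; first by left.
    by move=> ?; right; lra.
  by left => /=; rewrite ger0_norm; lra.
have gbeta : g p = g p'.
  apply: (@connected_locally_constant _ beta) => // q /lc; exact: filterS.
have [_ [[z Oz <-] /= gz]] := Op _ (lc p bp).
have [_ [[z' Oz' <-] /= gz']] := Op' _ (lc p' bp').
have sz : sheet z = false.
  by rewrite /sheet asboolF// => O'z; have : (O `&` O') z by []; rewrite OO'.
have sz' : sheet z' = true by rewrite /sheet asboolT.
have [Vz _] : (V `\` K) z by rewrite VK; left.
have [Vz' _] : (V `\` K) z' by rewrite VK; right.
move: gbeta; rewrite -gz -gz' /outer_section sz sz' (section_constant Vz Vz').
by case: (section z').
Qed.

End PlaneCover.

(** Unicoherence of the sphere in the form needed for boundary components. *)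
Lemma continuum_in_one_side (R : realType) (V K O O' : set (Cplx R))
    (beta : set (sphere R)) (p p' : sphere R) :
  open V -> connected V -> compact K -> K `<=` V ->
  open O -> open O' -> O `&` O' = set0 -> V `\` K = O `|` O' ->
  connected beta -> beta `&` in_sphere V = set0 ->
  beta p -> closure (in_sphere O) p -> beta p' -> closure (in_sphere O') p' -> False.
Proof.
move=> oV cV cK KV oO oO' OO' VK.
have [d d0 KdV] := compact_open_margin cK oV KV.
move=> cbeta bV; apply: (@boundary_continuum_one_side R V K O O' (d / 2)) => //.
  by rewrite divr_gt0.
move=> z; have [[k [zk Kk]]|zK] := pselect ((disc z (d / 2) `&` K) !=set0); last first.
  by right; apply/seteqP; split => // k zk; apply: zK; exists k.
left=> w zw; apply: (KdV k Kk); rewrite /disc /= in zk zw *.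
rewrite (_ : w - k = (w - z) - (k - z)); last by ring.
rewrite [d]splitr (le_lt_trans (normc_triangle _ _))// normcN.
exact: ltrD.
Qed.

(** * Components of compact sets are intersections of relatively clopen sets *)

Section Separation.
Variable R : realType.
Local Notation C := (Cplx R).
Implicit Types (A B K U V W Q : set C) (x y z w : C).

Definition fatten A (r : R) : set C := \bigcup_(z in A) disc z r.

Lemma fatten_open A r : open (fatten A r).
Proof. by apply: bigcup_open => z _; exact: disc_open. Qed.

Lemma subset_fatten A r : 0 < r -> A `<=` fatten A r.
Proof. by move=> r0 z Az; exists z => //; rewrite /disc /= subrr normc0. Qed.

Lemma compact_disjoint_fatten A B : compact A -> closed B -> A `&` B = set0 ->
  exists2 r : R, 0 < r & fatten A r `&` fatten B r = set0.
Proof.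
move=> cA cB AB.
have [d d0 dB] : exists2 d : R, 0 < d & forall z, A z -> disc z d `<=` ~` B.
  by apply: compact_open_margin; rewrite ?openC//; exact/disjoints_subset.
exists (d / 2); first by rewrite divr_gt0.
apply/seteqP; split => // w [[a Aa aw] [b Bb bw]].
apply: (dB a Aa b) => //; rewrite /disc /= in aw bw *.
rewrite (_ : b - a = (w - a) - (w - b)); last by ring.
rewrite [d]splitr (le_lt_trans (normc_triangle _ _))// normcN.
exact: ltrD.
Qed.

Definition clopen_in K A := [/\ A `<=` K, closed A & closed (K `\` A)].

Lemma clopen_in_setI K A B : clopen_in K A -> clopen_in K B -> clopen_in K (A `&` B).
Proof.
move=> [AK cA cA'] [BK cB cB']; split; first by move=> z [/AK].
  exact: closedI.
by rewrite setDIr; exact: closedU.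
Qed.

(** A quasi-component contains the component; on a compact set both coincide. *)
Definition quasi_component K x : set C :=
  [set y | forall A, clopen_in K A -> A x -> A y].

(** Relatively clopen sets containing x are stable under intersection, so by
    compactness one of them already avoids B. *)
Lemma quasi_component_avoid K x B : compact K -> K x -> closed B -> B `<=` K ->
  quasi_component K x `&` B = set0 ->
  exists A, [/\ clopen_in K A, A x & A `&` B = set0].
Proof.
move=> cK Kx cB BK QB.
pose D := [set A | clopen_in K A /\ A x].
(* The filter of all sufficiently small relatively clopen sets around x turns
   the finite intersection argument into one use of compactness of B. *)
pose F := filter_from D (fun A => [set A' | D A' /\ A' `<=` A]).
have FF : Filter F.
  apply: filter_from_filter.
    exists K; split => //; split => //; first by apply: compact_closed cK; exact: norm_hausdorff.
    by rewrite setDv; exact: closed0.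
  move=> A A' [cA Ax] [cA' A'x]; exists (A `&` A').
    by split; [exact: clopen_in_setI|].
  by move=> E [DE]; rewrite subsetI => -[EA EA'].
have cB' : compact B by exact: subclosed_compact cK BK.
have : \forall A \near F, B `<=` (fun z => ~ A z).
  move/compact_near_coveringP : cB'; apply => z Bz.
  have [A [cA [Ax nAz]]] : exists A, clopen_in K A /\ A x /\ ~ A z.
    apply: contrapT => H; suff : (quasi_component K x `&` B) z by rewrite QB.
    by split=> // A cA Ax; apply: contrapT => nAz; apply: H; exists A.
  exists (~` A, [set A' | D A' /\ A' `<=` A]) => /=.
    split; last by exists A.
    have [_ clA _] := cA; apply/nbhs_normcP.
    exact: (open_normcP _).1 (closed_openC clA) z nAz.
  by move=> [w A'] [/= nAw [_ A'A]] /A'A.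
move=> [A [cA Ax] H]; exists A; split => //.
by apply/seteqP; split => // z [Az /(H A (conj (conj cA Ax) (@subset_refl _ A)))].
Qed.

(** If the quasi-component split into two closed pieces, disjoint open
    neighbourhoods O0 and O1 of them would contain a relatively clopen set A
    around x, and A /\ O0 would be a relatively clopen set that excludes the
    second piece. *)
Lemma quasi_component_connected K x : compact K -> K x -> connected (quasi_component K x).
Proof.
move=> cK Kx; set Q := quasi_component K x.
have clK : closed K by apply: compact_closed cK; exact: norm_hausdorff.
have KK : clopen_in K K by split => //; rewrite setDv; exact: closed0.
have QK : Q `<=` K by move=> y /(_ K KK Kx).
have clQ : closed Q.
  rewrite (_ : Q = \bigcap_(A in [set A | clopen_in K A /\ A x]) A).
    by apply: closed_bigI => A [[]].
  apply/seteqP; split => y; first by move=> Qy A [cA Ax]; exact: Qy.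
  by move=> H A cA Ax; exact: H.
apply/connectedP => E [E0 QE [sE1 sE2]].
have clE b : closed (E b).
  rewrite closure_id; apply/seteqP; split; first exact: subset_closure.
  move=> y clEy.
  have : Q y.
    have -> : Q = closure Q by exact/closure_id.
    apply: closureS clEy; rewrite QE.
    by case: (b); [right|left].
  rewrite QE; case: (b) clEy => clEy [] // Ey; exfalso.
    by have : (E false `&` closure (E true)) y by []; rewrite sE2.
  by have : (closure (E false) `&` E true) y by []; rewrite sE1.
have cE b : compact (E b).
  apply: subclosed_compact cK _ => //; apply: subset_trans QK; rewrite QE.
  by case: (b); [right|left].
have Qx : Q x by move=> A.
pose b0 := ~~ `[< E false x >].
have Eb0 : E b0 x.
  by rewrite /b0; case: asboolP => //= nEx; move: Qx; rewrite QE => -[|//] /nEx.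
have dE : E b0 `&` E (~~ b0) = set0.
  apply/seteqP; split=> // y; case: (b0) => -[/= Ey E'y].
    have : (E false `&` closure (E true)) y by split => //; exact: subset_closure.
    by rewrite sE2.
  have : (E false `&` closure (E true)) y by split => //; exact: subset_closure.
  by rewrite sE2.
have [r r0 fE] := compact_disjoint_fatten (cE b0) (clE (~~ b0)) dE.
set O0 := fatten (E b0) r in fE; set O1 := fatten (E (~~ b0)) r in fE.
have [oO0 oO1] : open O0 /\ open O1 by split; exact: fatten_open.
have QO : Q `<=` O0 `|` O1.
  move=> y; rewrite QE => Ey.
  have : E b0 y \/ E (~~ b0) y by case: (b0) Ey => /= -[]; auto.
  by case=> ?; [left|right]; exact: subset_fatten.
have [|||A [cA Ax AO]] := @quasi_component_avoid K x (K `\` (O0 `|` O1)) cK Kx.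
- by apply: closedI => //; apply: open_closedC; exact: openU.
- by move=> ? [].
- by apply/seteqP; split => // y [/QO H [_]].
have [AK clA clA'] := cA.
have AO' y : A y -> O0 y \/ O1 y.
  move=> Ay; apply: contrapT => nO; have : (A `&` (K `\` (O0 `|` O1))) y.
    by split => //; split; [exact: AK|].
  by rewrite AO.
have nO y : O0 y -> O1 y -> False.
  by move=> ? ?; have : (O0 `&` O1) y by []; rewrite fE.
have cA2 : clopen_in K (A `&` O0).
  split; first by move=> y [/AK].
    rewrite (_ : A `&` O0 = A `&` ~` O1).
      by apply: closedI => //; exact: open_closedC.
    apply/seteqP; split=> y [Ay]; first by move=> O0y; split=> // /(nO _ O0y).
    by move=> nO1; split=> //; case: (AO' _ Ay).
  rewrite setDIr; rewrite (_ : (K `\` A) `|` (K `\` O0) = (K `\` A) `|` (K `&` ~` O0))//.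
  apply: closedU => //; apply: closedI => //; exact: open_closedC.
have [y Ey] := E0 (~~ b0).
have Qy : Q y by rewrite QE; case: (b0) Ey; [left|right].
have [_ O0y] := Qy _ cA2 (conj Ax (subset_fatten r0 Eb0)).
exact: nO O0y (subset_fatten r0 Ey).
Qed.

Lemma component_clopen_split K x B : compact K -> K x -> closed B -> B `<=` K ->
  connected_component K x `&` B = set0 ->
  exists A, [/\ clopen_in K A, connected_component K x `<=` A & A `&` B = set0].
Proof.
move=> cK Kx cB BK aB.
have clK : closed K by apply: compact_closed cK; exact: norm_hausdorff.
have QK : quasi_component K x `<=` K.
  by move=> y; apply => //; split => //; rewrite setDv; exact: closed0.
have [|A [cA Ax AB]] := @quasi_component_avoid K x B cK Kx cB BK.
  apply: subsetI_eq0 aB => //; apply: connected_component_max => //.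
  exact: quasi_component_connected.
exists A; split => //; have [AK clA clA'] := cA.
suff <- : connected_component K x `&` A = connected_component K x by move=> y [].
apply: component_connected.
- by exists x; split => //; exact: connected_component_refl.
- exists (~` (K `\` A)); first exact: closed_openC.
  apply/seteqP; split=> y [ay].
    by move=> Ay; split => // -[].
  move=> H; split => //; apply: contrapT => nAy; apply: H; split => //.
  exact: connected_component_sub ay.
- by exists A.
Qed.

End Separation.

(** * Components of the Fatou set *)

Section Components.
Variable R : realType.
Local Notation C := (Cplx R).
Implicit Types (F U : set C).

Lemma component_absorbs_connected (T : topologicalType) (F U B : set T) :
  is_component F U -> connected B -> B `<=` F -> B `&` U !=set0 -> B `<=` U.
Proof.
move=> [x Fx ->] cB BF [y [By xy]] z Bz.
by apply: (connected_component_trans xy); exists B.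
Qed.

Lemma is_component_properties (T : topologicalType) (F U : set T) :
  is_component F U -> [/\ connected U, U `<=` F & U !=set0].
Proof.
move=> [x Fx ->]; split; first exact: component_connected.
  exact: connected_component_sub.
by exists x; exact: connected_component_refl.
Qed.

(** A disc around z inside F meets U and is connected, so U absorbs it. *)
Lemma component_near_closure F U z : open F -> is_component F U -> F z -> closure U z ->
  \forall w \near z, U w.
Proof.
move=> oF cU Fz clUz; have [e e0 zF] := (open_normcP _).1 oF _ Fz.
apply/nbhs_normcP; exists e => //; apply: (component_absorbs_connected cU _ zF).
  exact/convex_connected/convex_disc.
by have [y [Uy zy]] := clUz _ (nbhs_disc z e0); exists y.
Qed.

Lemma open_component F U : open F -> is_component F U -> open U.
Proof.
move=> oF cU; rewrite openE => z Uz.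
have [_ UF _] := is_component_properties cU.
by apply: (component_near_closure oF cU); [exact: UF|exact: subset_closure].
Qed.

Lemma open_component_boundary F U z : open F -> is_component F U ->
  boundary U z -> ~ F z.
Proof.
by move=> oF cU [clU nU] Fz; apply: nU; exact: component_near_closure cU Fz clU.
Qed.

End Components.

Section Fatou.
Variable R : realType.
Local Notation C := (Cplx R).
Implicit Types (f g : C -> sphere R) (z w : C).

Lemma fatou_open f : open (fatou_set f).
Proof.
rewrite openE => z [N [[oN Nz] fN mN nN]]; rewrite /interior.
have := open_nbhs_nbhs (conj oN Nz); apply: filterS => w Nw.
by exists N.
Qed.

Lemma holomorphic_continuous g z : holomorphic_at g z -> {for z, continuous g}.
Proof.
move=> [h hP]; have [gz hz] := nbhs_singleton hP.
have [d /cderivative_continuous ch] := derivable_cderivative hz.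
move=> A; rewrite gz => /ch hA; suff : nbhs z (g @^-1` A) by [].
have := @filterI _ _ (nbhs_filter z) _ _ hP hA; apply: (@filterS _ _ (nbhs_filter z)) => w [[gw _] /=].
by rewrite gw.
Qed.

Lemma meromorphic_continuous g : meromorphic_on setT g -> continuous g.
Proof.
move=> mg z; have [//|/holomorphic_continuous//|[gz gl _]] := mg z.
move=> A; rewrite gz => nA; have := gl A nA; rewrite nbhs_simpl /= => H.
suff : nbhs z (g @^-1` A) by [].
have : \forall w \near z, w != z -> A (g w) by [].
apply: (@filterS _ _ (nbhs_filter z)) => w H'; have [->|wz] := eqVneq w z; last exact: H'.
by rewrite /preimage /= gz; exact: nbhs_singleton nA.
Qed.

Lemma iterateS f n z w : f z = Some w -> iterate f n.+1 z = iterate f n w.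
Proof. by move=> fz; rewrite /iterate iterSr /= fz. Qed.

Lemma chordal_refl (p : sphere R) : chordal p p = 0.
Proof. by case: p => [z|] //=; rewrite subrr normc0 mulr0 mul0r. Qed.

Lemma holomorphic_comp f g h z w0 : (\forall w \near z, f w = g (h w)) ->
  (\forall w \near z, derivable h w 1) -> h z = w0 ->
  holomorphic_at g w0 -> holomorphic_at f z.
Proof.
move=> /nbhs_normcP[r1 r10 fgh] /nbhs_normcP[r2 r20 dh] hz [k /nbhs_normcP[e e0 kP]].
exists (k \o h).
have dhz : derivable h z 1 by apply: dh; rewrite subrr normc0.
have [d /cderivative_continuous/continuous_normcP/(_ e e0)[r r0 hr]] := derivable_cderivative dhz.
apply/nbhs_normcP; exists (Num.min r (Num.min r1 r2)); first by rewrite !lt_min r0 r10.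
move=> w; rewrite !lt_min => /and3P[/hr hw /fgh fw /dh dw].
rewrite hz in hw; have [gk dk] := kP _ hw.
split; first by rewrite fw gk.
have [a ha] := derivable_cderivative dw; have [b kb] := derivable_cderivative dk.
exact: cderivative_derivable (cderivative_comp ha kb).
Qed.

(** All iterates are finite on the neighbourhood N of w = f(z), hence holomorphic
    there, and f is holomorphic at z since f(z) is finite; composing with f
    therefore never creates a pole.  Normality near z comes from normality
    near w, after shifting the exponents by one. *)
Lemma fatou_preimage f z w : meromorphic_on setT f -> f z = Some w ->
  fatou_set f w -> fatou_set f z.
Proof.
move=> mf fz [N [[oN Nw] defN merN normN]].
have [//|[h hP]|[fz' _ _]] := mf z; last by rewrite fz' in fz.
have [B [oB Bz hB]] : exists B : set C, [/\ open B, B z &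
    forall s, B s -> f s = Some (h s) /\ derivable h s 1].
  have [r r0 H] := (nbhs_normcP _ _).1 hP; exists (disc z r); split => //.
    exact: disc_open.
  by rewrite /disc /= subrr normc0.
have nB s : B s -> exists2 r : R, 0 < r & disc s r `<=` B.
  exact: (open_normcP B).1.
have ch s : B s -> {for s, continuous h}.
  move=> /hB[_ /derivable_cderivative[d /cderivative_continuous //]].
have hz : h z = w by have [+ _] := hB _ Bz; rewrite fz => -[].
have oN' : open (B `&` h @^-1` N).
  rewrite openE => s [Bs Nhs]; apply: filterI; first exact: open_nbhs_nbhs.
  by apply: (ch s Bs); exact: open_nbhs_nbhs.
exists (B `&` h @^-1` N); split.
- by split => //; split => //; rewrite /= hz.
- move=> n s [Bs Ns] [_|k kn]; first by [].
  have [fs _] := hB s Bs; rewrite (iterateS _ fs).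
  exact: (defN k.+1).
- move=> [|n] s [Bs Ns]; left.
    exists id; apply/nbhs_normcP; exists 1 => // t _; split => //; exact: derivable_id.
  have [hol|[]] := merN n _ Ns; last first.
    by have := defN n.+1 (h s) Ns n (ltnSn n).
  apply: (@holomorphic_comp _ (iterate f n) h s) => //.
    have [r r0 rB] := nB s Bs; apply/nbhs_normcP; exists r => // t /rB/hB[ft _].
    exact: iterateS.
  have [r r0 rB] := nB s Bs; apply/nbhs_normcP; exists r => // t /rB/hB[_].
  exact.
move=> u uf.
have /boolp.choice[m mP] : forall n, exists k, iterate f k = u n by move=> n; have [k _ <-] := uf n; exists k.
(* A sequence of iterates uses the exponent 0 infinitely often, and has a
   constant subsequence, or all its exponents are eventually positive. *)
have [inf0|] := pselect (forall n0, exists n, (n0 <= n)%N /\ m n = 0%N).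
  have /boolp.choice[nx nxP] := inf0.
  pose phi := fix phi n : nat := if n is k.+1 then nx (phi k).+1 else nx 0%N.
  have m0 n : m (phi n) = 0%N by case: n => [|n] /=; apply: (nxP _).2.
  exists phi; split.
    apply/increasing_seqP => n /=; rewrite ltEnat /=; exact: (nxP _).1.
  exists (iterate f 0) => s Ns; exists setT; first exact: filterT.
  move=> e e0; near=> n => t _; by rewrite /= -mP m0 chordal_refl.
move=> /existsNP[n0 n0P].
have mpos n : (n0 <= n)%N -> (0 < m n)%N.
  by move=> nn; rewrite lt0n; apply/eqP => mn; apply: n0P; exists n.
have [n|phi [incphi [g gP]]] := normN (fun n => iterate f (m (n0 + n)%N).-1).
  by exists (m (n0 + n)%N).-1.
exists (fun n => n0 + phi n)%N; split.
  apply/increasing_seqP => n; rewrite ltEnat /= ltn_add2l.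
  by have /increasing_seqP/(_ n) := incphi.
exists (g \o h) => s [Bs Ns]; have [N' N'hs gN'] := gP _ Ns.
exists (B `&` h @^-1` N').
  by apply: filterI; [exact: open_nbhs_nbhs|exact: ch Bs _ N'hs].
move=> e e0; have := gN' e e0; apply: filterS => n H t [Bt N't].
have [ft _] := hB t Bt.
rewrite /= -mP -(prednK (mpos _ (leq_addr (phi n) n0))) (iterateS _ ft).
exact: H.
Unshelve. all: by end_near. Qed.

End Fatou.

(** * Images under meromorphic functions *)

Section SphereTopology.
Variable R : realType.
Local Notation C := (Cplx R).
Implicit Types (f : C -> sphere R) (A G X : set C) (z w : C).

Lemma sphere_hausdorff : hausdorff_space (sphere R).
Proof.
have far z : nbhs (infty : sphere R) [set p | if p is Some w then normc z + 1 < normc w else True].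
  by apply/nbhs_inftyP; split => //; exists (normc z + 1).
have near z : nbhs (Some z : sphere R) (Some @` disc z 1).
  by apply: one_point_compactification_some_nbhs; exact: nbhs_disc.
have sep z w : normc (z - w) < 1 -> normc w + 1 < normc z -> False.
  by have := normc_triangle (z - w) w; rewrite subrK; lra.
move=> [z|] [w|] //.
- move=> H; have [->//|zw] := eqVneq z w; exfalso.
  have d0 : 0 < normc (w - z) / 2 by rewrite divr_gt0// normc_gt0 subr_eq0 eq_sym.
  have [] := H (Some @` disc z (normc (w - z) / 2)) (Some @` disc w (normc (w - z) / 2)).
  + by apply: one_point_compactification_some_nbhs; exact: nbhs_disc.
  + by apply: one_point_compactification_some_nbhs; exact: nbhs_disc.
  move=> _ [[s zs <-] [t wt [st]]]; rewrite st /disc /= in wt; rewrite /disc /= in zs.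
  have := normc_triangle (s - z) (w - s); rewrite [s - z + _]addrC addrA subrK [normc (w - s)]normcB.
  by lra.
- move=> H; exfalso; have [] := H _ _ (near z) (far z).
  by move=> _ [[s zs <-] /= ls]; exact: sep zs ls.
- move=> H; exfalso; have [] := H _ _ (far w) (near w).
  by move=> q [/= ls [s ws E]]; move: ls; rewrite -E => ls; exact: sep ws ls.
Qed.

Lemma compact_image_closed f A : continuous f -> compact A -> closed (f @` A).
Proof.
move=> cf cA; apply: compact_closed; first exact: sphere_hausdorff.
by apply: continuous_compact => //; exact: continuous_subspaceT.
Qed.

Definition finite_part f z : C := if f z is Some a then a else 0.


(** Vanishing at infinity makes this continuous on the sphere without w. *)
Definition sphere_inv w (p : sphere R) : C := if p is Some a then (a - w)^-1 else 0.

Lemma sphere_inv_continuous w (p : sphere R) : p <> Some w ->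
  {for p, continuous (sphere_inv w)}.
Proof.
case: p => [a|] pw.
  have aw : a - w != 0 by rewrite subr_eq0; apply/eqP => aw; apply: pw; rewrite aw.
  have n0 : 0 < normc (a - w) by rewrite normc_gt0.
  suff : {for a, continuous (fun s : C => (s - w)^-1)} by [].
  apply/continuous_normcP => e e0; pose n := normc (a - w).
  have n20 : 0 < n ^+ 2 / 2 by rewrite divr_gt0// exprn_gt0.
  exists (Num.min (n / 2) (e * (n ^+ 2 / 2))); first by rewrite lt_min divr_gt0//= mulr_gt0.
  move=> s; rewrite lt_min => /andP[sa se].
  have ns : n / 2 < normc (s - w).
    have := normc_triangle (a - s) (s - w); rewrite addrA subrK normcB -/n; lra.
  have sw : s - w != 0 by rewrite -normc_gt0; apply: lt_trans ns; rewrite divr_gt0.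
  rewrite (_ : _ - _ = (a - s) / ((s - w) * (a - w))); last first.
    by field; rewrite sw aw.
  rewrite normcM normcV normcM normcB ltr_pdivrMr; last by rewrite mulr_gt0// normc_gt0.
  apply: (lt_le_trans se); rewrite ler_pM2l// -/n (_ : n ^+ 2 / 2 = n / 2 * n); last by ring.
  by rewrite ler_pM2r// ltW.
move=> A /nbhs_normcP[e e0 eA]; apply/nbhs_inftyP; split.
  by apply: eA; rewrite subrr normc0.
exists (normc w + e^-1) => s ws; apply: eA; rewrite subr0 normcV.
have := normc_triangle (s - w) w; rewrite subrK => tri.
have lt : e^-1 < normc (s - w) by lra.
by rewrite -[e]invrK ltf_pV2 ?posrE ?invr_gt0//; apply: lt_trans lt; rewrite invr_gt0.
Qed.

Lemma cderivative_inv (h : C -> C) z (a : C) : h z != 0 -> cderivative h z a ->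
  exists b, cderivative (fun s => (h s)^-1) z b.
Proof.
move=> hz ha; apply: derivable_cderivative; apply: derivableV => //.
exact: cderivative_derivable ha.
Qed.

End SphereTopology.

Section OpenImage.
Variable R : realType.
Local Notation C := (Cplx R).
Implicit Types (f : C -> sphere R) (A G X : set C) (z w : C).

Lemma finite_meromorphic_derivative f z : meromorphic_on setT f -> f z <> infty ->
  exists a, cderivative (finite_part f) z a.
Proof.
move=> mf fz; have [//|[h hP]|[]//] := mf z.
have [r r0 H] := (nbhs_normcP _ _).1 hP.
have [|fzE dz] := H z; first by rewrite subrr normc0.
have [a ha] := derivable_cderivative dz; exists a => e /ha[r' r'0 {}ha].
exists (Num.min r r'); first by rewrite lt_min r0.
move=> s; rewrite lt_min => /andP[/H[fsE _] /ha].
by rewrite /finite_part fzE fsE.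
Qed.

(** If w is close to w0 = f(z0) but not attained on G, then 1 / (f - w), equal to
    0 at the poles, is continuous on X and holomorphic on G.  It is large at
    z0, and it is bounded on X minus G by the inverse of half the distance from
    w0 to f(X minus G), against the maximum modulus principle.  The hypothesis
    on X minus G plays the part of nonconstancy in the open mapping theorem. *)
Lemma meromorphic_image_nbhs f G X z0 w0 : meromorphic_on setT f ->
  compact X -> open G -> G `<=` X -> (forall z, G z -> f z <> infty) ->
  G z0 -> f z0 = Some w0 -> (forall z, X z -> ~ G z -> f z <> Some w0) ->
  nbhs w0 [set w | exists2 z, G z & f z = Some w].
Proof.
move=> mf cX oG GX Gfin Gz0 fz0 Yw0.
have cf := meromorphic_continuous mf.
have clX : closed X by apply: compact_closed cX; exact: norm_hausdorff.
have cY : compact (X `\` G).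
  apply: (@subclosed_compact _ (X `\` G) X _ cX); last exact: subDsetl.
  by apply: closedI => //; exact: open_closedC.
have : nbhs (Some w0 : sphere R) (~` (f @` (X `\` G))).
  apply: open_nbhs_nbhs; split; first by apply: closed_openC; exact: compact_image_closed.
  by move=> [z [Xz Gz]]; exact: Yw0.
move=> /(nbhs_normcP w0)[d d0 dY].
apply/nbhs_normcP; exists (d / 2); first by rewrite divr_gt0.
move=> w ww0; apply: contrapT => nw.
have Gw z : G z -> f z <> Some w by move=> Gz fz; apply: nw; exists z.
have Xw z : X z -> f z <> Some w.
  move=> Xz fz; have [/Gw//|Gz] := pselect (G z).
  apply: (dY w); first by apply: lt_trans ww0 _; rewrite ltr_pdivrMr// ltr_pMr// ltr1n.
  by exists z.
pose g z := sphere_inv w (f z).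
have [||q [Xq Gq]] := @maximum_modulus_principle R X G g cX oG GX _ _ z0 (GX _ Gz0).
- move=> z Xz; apply: continuous_comp; first exact: cf.
  exact: sphere_inv_continuous (Xw z Xz).
- move=> z Gz; have [a ha] := finite_meromorphic_derivative mf (Gfin z Gz).
  have nz : finite_part f z - w != 0.
    rewrite subr_eq0; apply/eqP => E; apply: (Xw z (GX z Gz)); move: E (Gfin z Gz).
    by rewrite /finite_part; case: (f z) => // b ->.
  have ha' : cderivative (fun s => finite_part f s - w) z a.
    move=> e /ha[r r0 H]; exists r => // s /H.
    by rewrite (_ : finite_part f s - w - _ = finite_part f s - finite_part f z)//; ring.
  have [b hb] := @cderivative_inv R (fun s => finite_part f s - w) z a nz ha'.
  have [r r0 zG] := (open_normcP G).1 oG z Gz.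
  have gE s : G s -> g s = (finite_part f s - w)^-1.
    by move=> /Gfin; rewrite /g /finite_part; case: (f s).
  exists b => e /hb[r' r'0 H]; exists (Num.min r r'); first by rewrite lt_min r0.
  by move=> s; rewrite lt_min => /andP[/zG Gs /H]; rewrite !gE.
rewrite /g fz0 /=.
have w0w : w0 - w != 0.
  by rewrite subr_eq0; apply/eqP => E; apply: (Gw z0 Gz0); rewrite fz0 E.
have n0 : 0 < normc (w0 - w) by rewrite normc_gt0.
have big : 2 / d < normc (w0 - w)^-1.
  rewrite normcV -[2 / d]invrK ltf_pV2 ?posrE// ?invr_gt0 ?divr_gt0//.
  by rewrite invf_div normcB.
have d20 : 0 < d / 2 by rewrite divr_gt0.
case fq : (f q) => [a|] /=; last first.
  rewrite [X in _ <= X](_ : _ = 0); last exact: normc0.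
  by rewrite leNgt (lt_trans _ big)// divr_gt0.
have aw0 : d <= normc (a - w0).
  by rewrite leNgt; apply/negP => /dY; apply; exists q.
have aw : d / 2 <= normc (a - w).
  have := normc_triangle (a - w) (w - w0); rewrite addrA subrK; lra.
have : normc (a - w)^-1 <= 2 / d.
  rewrite normcV -[2 / d]invrK lef_pV2 ?posrE ?invf_div//.
  exact: lt_le_trans aw.
by move=> H1 H2; have := lt_le_trans big (le_trans H2 H1); rewrite ltxx.
Qed.

End OpenImage.

(** * Images of boundary components *)

Section Boundary.
Variable R : realType.
Local Notation C := (Cplx R).
Implicit Types (f : C -> sphere R) (A G X U V : set C) (z w : C).

Lemma bounded_closure_compact U : bounded_set U -> compact (closure U).
Proof.
move=> [M [Mreal UM]].
have [m UMm] : exists m : R, forall z, U z -> normc z <= m.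
  exists (complex.Re M + 1) => z Uz.
  have MM : M < (complex.Re M + 1)%:C%C.
    move: Mreal; case: (M) => a b; rewrite complex_real => /eqP /= ->.
    by rewrite ltcE /= eqxx /= ltrDl ltr01.
  by have := UM _ MM z Uz; rewrite /= norm_normc lecR.
apply: (@bounded_closed_compactC R _ m); first exact: closed_closure.
suff : closure U `<=` closure [set z : C | normc z <= m].
  by rewrite -((closure_id _).1 (@closed_normc_le R m)).
exact: closureS.
Qed.

Lemma boundary_open (T : topologicalType) (A : set T) : open A ->
  boundary A = closure A `\` A.
Proof. by move=> oA; rewrite /boundary ((interior_id A).1 oA). Qed.

(** Only topological properties of the Fatou components are used: openness, the
    connectedness of V, and the fact that boundary points of U are not mapped
    into V. *)
Lemma image_component_boundary f U V alpha x :
  meromorphic_on setT f -> open U -> open V -> connected V -> compact (closure U) ->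
  f @` U `<=` in_sphere V -> (forall z, boundary U z -> ~ in_sphere V (f z)) ->
  boundary U x -> alpha = connected_component (boundary U) x ->
  f @` alpha = connected_component (boundary (in_sphere V)) (f x).
Proof.
move=> mf oU oV cV cX fUV fbU bx ->; set al := connected_component _ _.
have cf := meromorphic_continuous mf.
have oSV : open (in_sphere V) by exact: one_point_compactification_open_some.
have bUE := boundary_open oU; have bVE := boundary_open oSV.
have fX z : closure U z -> closure (in_sphere V) (f z).
  move=> Uz N /(cf z) fN; have [s [Us Ns]] := Uz _ fN.
  by exists (f s); split => //; apply: fUV; exists s.
have fb z : boundary U z -> boundary (in_sphere V) (f z).
  move=> bz; rewrite bVE; split; last exact: fbU.
  by apply: fX; move: bz; rewrite bUE => -[].
have alb : al `<=` boundary U by exact: connected_component_sub.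
have alx : al x by exact: connected_component_refl.
apply/seteqP; split.
  apply: connected_component_max; first by exists x.
    by move=> _ [z /alb/fb bz <-].
  apply: connected_continuous_connected; first exact: component_connected.
  exact: continuous_subspaceT.
move=> w0 bw0; apply: contrapT => nw0.
set beta := connected_component _ _ in bw0.
have betab : beta `<=` boundary (in_sphere V) by exact: connected_component_sub.
have clbU : closed (boundary U).
  by rewrite bUE; apply: closedI; [exact: closed_closure|exact: open_closedC].
have cbU : compact (boundary U).
  by apply: (subclosed_compact clbU cX); rewrite bUE => z [].
(* Assuming that w0 in beta is not attained on alpha, the fibre Z over w0 can be
   split off from alpha. *)
pose Z := boundary U `&` f @^-1` [set w0].
have clZ : closed Z.
  apply: closedI => //; apply: closed_comp; first by move=> z _; exact: cf.
  by apply: accessible_closed_set1; apply: hausdorff_accessible; exact: sphere_hausdorff.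
have [||A [[AbU clA clB] alA AZ]] := component_clopen_split cbU bx clZ.
- by move=> z [].
- by apply/seteqP; split=> // z [alz [_ fz]]; apply: nw0; exists z.
set B := boundary U `\` A in clB.
have [r r0 AB] : exists2 r : R, 0 < r & fatten A r `&` fatten B r = set0.
  apply: compact_disjoint_fatten => //; first exact: (subclosed_compact clA cbU).
  by apply/seteqP; split => // z [Az []].
set W := fatten A r in AB; have oW : open W by exact: fatten_open.
have AW : A `<=` W := @subset_fatten R A r r0.
have WB : closure W `&` B = set0.
  apply/seteqP; split => // z [clWz Bz].
  have [s [Ws zs]] := clWz _ (nbhs_disc z r0).
  have : (W `&` fatten B r) s by split => //; exists z.
  by rewrite AB.
pose G := W `&` U; have oG : open G by exact: openI.
(* D is the part of the boundary of W that lies in closure U; it stays inside U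
   because boundary U is the union of A, contained in W, and of B, which
   closure W misses. *)
pose D := closure W `&` closure U `&` ~` W.
have DU : D `<=` U.
  move=> z [[Wz Uz] nW]; apply: contrapT => nU.
  have bz : boundary U z by rewrite bUE.
  have [Az|nAz] := pselect (A z); first exact/nW/AW.
  by have : (closure W `&` B) z by []; rewrite WB.
have cD : compact D.
  apply: (subclosed_compact _ cX); last by move=> z [[]].
  apply: closedI; last exact: open_closedC.
  by apply: closedI; exact: closed_closure.
pose X := closure G.
have XU : X `<=` closure U by apply: closureS => z [].
have XW : X `<=` closure W by apply: closureS => z [].
have cXG : compact X by apply: (subclosed_compact _ cX XU); exact: closed_closure.
have GX : G `<=` X by exact: subset_closure.
have XG z : X z -> ~ G z -> A z \/ D z.
  move=> Xz nG; have [Wz|nWz] := pselect (W z); last first.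
    by right; split => //; split; [exact: XW|exact: XU].
  left; apply: contrapT => nA; have [Uz|nU] := pselect (U z); first exact: nG.
  have bz : boundary U z by rewrite bUE; split; [exact: XU|].
  have : (closure W `&` B) z := conj (XW z Xz) (conj bz nA).
  by rewrite WB.
have fU z : U z -> exists2 v, V v & f z = Some v.
  by move=> Uz; have [v Vv <-] := fUV (f z) (ex_intro2 _ _ z Uz erefl); exists v.
pose K := [set w | exists2 z, D z & f z = Some w].
have KE : in_sphere K = f @` D.
  apply/seteqP; split => [_ [w [z Dz fz] <-]|_ [z Dz <-]]; first by exists z.
  by have [v Vv fz] := fU _ (DU _ Dz); rewrite fz; exists v => //; exists z.
have KV : K `<=` V.
  by move=> w [z /DU/fU[v Vv ->] [<-]].
have clK' : closed (f @` D) by exact: compact_image_closed.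
have cK : compact K.
  rewrite (_ : K = finite_part f @` D).
    apply: continuous_compact => //; apply: continuous_in_subspaceT => z /set_mem /DU/fU[v _ fz].
    have [|a] := @finite_meromorphic_derivative R f z mf; first by rewrite fz.
    exact: cderivative_continuous.
  apply/seteqP; split => [w [z Dz fz]|w [z Dz <-]].
    by exists z => //; rewrite /finite_part fz.
  have [v _ fz] := fU _ (DU _ Dz).
  by exists z => //; rewrite /finite_part fz.
pose H := [set w | exists2 z, G z & f z = Some w].
pose O := H `\` K; pose O' := V `\` (K `|` H).
have HV : H `<=` V by move=> w [z [_ /fU[v Vv ->]] [<-]].
have nK (p : sphere R) : ~ (f @` D) p -> nbhs p (~` (f @` D)).
  by move=> np; apply: open_nbhs_nbhs; split => //; exact: closed_openC.
have oO : open O.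
  apply/open_normcP => w [[z Gz fz] nKw].
  have Hw : nbhs w H.
    apply: (meromorphic_image_nbhs mf cXG oG GX _ Gz fz).
      by move=> s [_ /fU[v _ ->]].
    move=> s Xs /(XG s Xs)[As fs|Ds fs]; last by apply: nKw; exists s.
    apply: (fbU s (AbU _ As)); rewrite fs; exists w => //.
    by apply: HV; exists z.
  have nKw' : nbhs (Some w : sphere R) (~` (f @` D)).
    by apply: nK; rewrite -KE => -[v Kv [vw]]; apply: nKw; rewrite -vw.
  have [r1 r10 H1] := (nbhs_normcP _ _).1 Hw.
  have [r2 r20 H2] := (nbhs_normcP w _).1 nKw'.
  exists (Num.min r1 r2); first by rewrite lt_min r10.
  move=> s; rewrite /disc /= lt_min => /andP[/H1 Hs /H2 /= ns].
  by split.
have clX' : closed (f @` X) by exact: compact_image_closed.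
have oO' : open O'.
  apply/open_normcP => w [Vw nKH].
  have nX : nbhs (Some w : sphere R) (~` (f @` X)).
    apply: open_nbhs_nbhs; split; first exact: closed_openC.
    move=> [z Xz fz]; apply: nKH.
    have [Gz|/(XG z Xz)[Az|Dz]] := pselect (G z); [by right; exists z| |by left; exists z].
    by exfalso; apply: (fbU z (AbU _ Az)); rewrite fz; exists w.
  have nD : nbhs (Some w : sphere R) (~` (f @` D)).
    by apply: nK; rewrite -KE => -[v Kv [vw]]; apply: nKH; left; rewrite -vw.
  have [r1 r10 H1] := (open_normcP _).1 oV w Vw.
  have [r2 r20 H2] := (nbhs_normcP w _).1 nX.
  have [r3 r30 H3] := (nbhs_normcP w _).1 nD.
  exists (Num.min r1 (Num.min r2 r3)); first by rewrite !lt_min r10 r20.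
  move=> s; rewrite /disc /= !lt_min => /and3P[/H1 Hs /H2 /= ns /H3 /= ns'].
  split => // -[] [z Dz fz]; first by apply: ns'; exists z.
  by apply: ns; exists z => //; exact: GX.
have fbx : ~ in_sphere V (f x) := fbU x bx.
apply: (@continuum_in_one_side R V K O O' beta (f x) w0) => //.
- by apply/seteqP; split => // w [[Hw _] [_ nKH]]; apply: nKH; right.
- apply/seteqP; split => w; last by case=> [[/HV Vw nKw]|[Vw nKH]]; split => // Kw; apply: nKH; left.
  move=> [Vw nKw]; have [Hw|nHw] := pselect (H w); [by left|right].
  by split => // -[].
- exact: component_connected.
- apply/seteqP; split => // p [/betab]; rewrite bVE => -[_ nV] //.
- by apply: connected_component_refl; exact: fb.
- move=> N Nfx.
  have nDx : nbhs (f x) (~` (f @` D)).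
    by apply: nK; rewrite -KE => -[v /KV Vv vfx]; apply: fbx; exists v.
  have [r1 r10 H1] := (nbhs_normcP x _).1 (cf x _ Nfx).
  have [r2 r20 H2] := (nbhs_normcP x _).1 (cf x _ nDx).
  have [r3 r30 H3] := (open_normcP _).1 oW x (AW x (alA x alx)).
  have clx : closure U x by move: bx; rewrite bUE => -[].
  have m0 : 0 < Num.min r1 (Num.min r2 r3) by rewrite !lt_min r10 r20.
  have [s [Us]] := clx _ (nbhs_disc x m0).
  rewrite /disc /= !lt_min => /and3P[/H1 Ns /H2 /= nDs /H3 Ws].
  exists (f s); split => //; have [v Vv fs] := fU s Us; rewrite fs; exists v => //.
  split; first by exists s.
  by move=> [z Dz fz]; apply: nDs; exists z => //; rewrite fz fs.
- have [clw0 nVw0] : closure (in_sphere V) w0 /\ ~ in_sphere V w0.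
    by have := betab _ bw0; rewrite bVE.
  have nDw : nbhs w0 (~` (f @` D)).
    by apply: nK; rewrite -KE => -[v /KV Vv vw]; apply: nVw0; exists v.
  have nXw : nbhs w0 (~` (f @` X)).
    apply: open_nbhs_nbhs; split; first exact: closed_openC.
    move=> [z Xz fz]; have nUz : ~ U z.
      by move=> /fU[v Vv fzv]; apply: nVw0; exists v => //; rewrite -fz fzv.
    have [[_ Uz]|/(XG z Xz)[Az|/DU//]] := pselect (G z); first exact: nUz.
    have : (A `&` Z) z := conj Az (conj (AbU z Az) fz).
    by rewrite AZ.
  move=> N Nw0; have [_ [[v Vv <-] [Nv [nDv nXv]]]] := clw0 _ (filterI Nw0 (filterI nDw nXw)).
  exists (Some v); split => //; exists v => //; split => // -[] [z Dz fz].
    by apply: nDv; exists z.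
  by apply: nXv; exists z => //; exact: GX.
Qed.

End Boundary.

Unset Implicit Arguments.

Theorem theorem4 (R : realType) (f : Cplx R -> sphere R) (U V : set (Cplx R))
    (hf : meromorphic_on setT f)
    (hU : is_component (fatou_set f) U) (hUb : bounded_set U)
    (hV : is_component (fatou_set f) V) (hUV : f @` U `<=` in_sphere V) :
  forall alpha : set (Cplx R), is_component (boundary U) alpha ->
    is_component (boundary (in_sphere V)) (f @` alpha).
Proof.
move=> alpha [x bx alE].
have oF : open (fatou_set f) by exact: fatou_open.
have [oU oV] := (open_component oF hU, open_component oF hV).
have [cV VF _] := is_component_properties hV.
have fbU z : boundary U z -> ~ in_sphere V (f z).
  move=> bz [v Vv fz]; apply: (open_component_boundary oF hU bz).
  by apply: (fatou_preimage hf (esym fz)); exact: VF.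
have fal := image_component_boundary hf oU oV cV (bounded_closure_compact hUb) hUV fbU bx alE.
exists (f x) => //.
have : connected_component (boundary (in_sphere V)) (f x) (f x).
  by rewrite -fal; exists x => //; rewrite alE; exact: connected_component_refl.
exact: connected_component_sub.
Qed.
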